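(* Let $V\in L^\infty(0,2\pi)$ be complex-valued with imaginary part $V_I$ satisfying $V_I(x)\geq0$ for almost every $x$ and $V_I(x)>0$ on a set of positive Lebesgue measure. For any $\lambda\in\mathbb{R}$ there exists a unique pair $\rho_\lambda\in\mathbb{C}$, $k_\lambda\in L^2(0,2\pi)$ such that $A_{\rho_\lambda,k_\lambda}$ is a maximally dissipative extension of $A_{min}$ with $\lambda\in\sigma(A_{\rho_\lambda,k_\lambda})$.
   Context: The Hilbert space is $L^2(0,2\pi)$ (complex-valued functions). The minimal operator is $A_{min}f=if'+Vf$ on $\mathrm{dom}(A_{min})=\{f\in H^1(0,2\pi)\mid f(0)=f(2\pi)=0\}$. For $\rho\in\mathbb{C}$, $k\in L^2(0,2\pi)$, $$\mathrm{dom}(A_{\rho,k})=\{f\in H^1(0,2\pi)\mid f(0)=\rho f(2\pi)\},\qquad (A_{\rho,k}f)(x)=if'(x)+V(x)f(x)+f(2\pi)k(x).$$ With inner product linear in the second argument, a densely defined operator $A$ is dissipative if $\mathrm{Im}\langle f,Af\rangle\geq0$ for all $f\in\mathrm{dom}(A)$, and maximally dissipative if it is dissipative and has no non-trivial dissipative operator extension. *)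

(* Defs.v *)
From mathcomp Require Import all_boot all_order all_algebra.
From mathcomp Require Import all_classical all_reals all_analysis.
From mathcomp Require Import complex.

Set Implicit Arguments.
Unset Strict Implicit.
Unset Printing Implicit Defensive.

Import Order.TTheory GRing.Theory Num.Theory.
Import numFieldNormedType.Exports.

Local Open Scope classical_set_scope.
Local Open Scope ring_scope.

(* Elements of L^2(0,2pi) are represented by functions R -> R[i]; their values
   outside of ]0, 2pi[ are irrelevant and equality in L^2 is [eqae]. *)

Definition interval02pi (R : realType) : set R := `]0, 2 * pi[%classic.
Arguments interval02pi : clear implicits.

Section L2.
Variable R : realType.
Implicit Types f g : R -> R[i].

Local Notation D := (interval02pi R).
Local Notation mu := (@lebesgue_measure R).
Local Notation normc := ComplexField.Normc.normc.

Definition measurableC f : Prop :=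
  measurable_fun D (fun x => complex.Re (f x)) /\
  measurable_fun D (fun x => complex.Im (f x)).

Definition integralC (A : set R) f : R[i] :=
  Complex (\int[mu]_(x in A) complex.Re (f x))
          (\int[mu]_(x in A) complex.Im (f x)).

Definition eqae f g : Prop := ae_eq mu D f g.

Definition L2 f : Prop :=
  measurableC f /\ (\int[mu]_(x in D) ((normc (f x)) ^+ 2)%:E < +oo)%E.

Definition Linfty f : Prop :=
  measurableC f /\
  exists M : R, {ae mu, forall x, D x -> normc (f x) <= M}.

Definition L2norm f : R := Num.sqrt (\int[mu]_(x in D) (normc (f x)) ^+ 2).

Definition inner f g : R[i] := integralC D (fun x => conjc (f x) * g x).

(* [u] is the absolutely continuous representative on [0, 2pi] of an element
   of H^1(0,2pi), and [du] is a representative of its derivative: absolute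
   continuity is expressed by [u] being an indefinite integral of [du]. *)
Definition H1_repr (u du : R -> R[i]) : Prop :=
  L2 du /\
  forall x, x \in `[0, 2 * pi] -> u x = u 0 + integralC `]0, x[%classic du.

(* An operator in L^2(0,2pi) is given by its graph. *)
Definition graph := set ((R -> R[i]) * (R -> R[i])).
Implicit Types S T : graph.

Record is_operator T : Prop := IsOperator {
  operator_L2 : forall f g, T (f, g) -> L2 f /\ L2 g;
  operator_eqae : forall f g f' g', T (f, g) -> L2 f' -> L2 g' ->
    eqae f f' -> eqae g g' -> T (f', g');
  operator_fun : forall f g g', T (f, g) -> T (f, g') -> eqae g g';
  operator_zero : T (fun=> 0, fun=> 0);
  operator_linear : forall (a : R[i]) f g f' g', T (f, g) -> T (f', g') ->
    T (fun x => a * f x + f' x, fun x => a * g x + g' x) }.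

Definition dom T : set (R -> R[i]) := [set f | exists g, T (f, g)].

Definition densely_defined T : Prop :=
  forall h, L2 h -> forall e : R, 0 < e ->
    exists f, dom T f /\ L2norm (fun x => h x - f x) < e.

Definition extension S T : Prop := S `<=` T.

Definition dissipative T : Prop :=
  [/\ is_operator T, densely_defined T &
      forall f g, T (f, g) -> 0 <= complex.Im (inner f g)].

Definition maximally_dissipative T : Prop :=
  dissipative T /\
  forall S, dissipative S -> extension T S -> S = T.

Definition resolvent_set T : set R[i] := [set z |
  [/\ forall f g, T (f, g) -> eqae g (fun x => z * f x) -> eqae f (fun=> 0),
      forall h, L2 h ->
        exists f g, T (f, g) /\ eqae (fun x => g x - z * f x) h &
      exists c : R, forall f g, T (f, g) ->
        L2norm f <= c * L2norm (fun x => g x - z * f x)]].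

Definition spectrum T : set R[i] := ~` resolvent_set T.

Definition A_min (V : R -> R[i]) : graph := [set fg |
  [/\ L2 fg.1, L2 fg.2 & exists u du,
    [/\ H1_repr u du, eqae fg.1 u, u 0 = 0, u (2 * pi) = 0 &
        eqae fg.2 (fun x => 'i%C * du x + V x * u x)]]].

Definition A_op (V : R -> R[i]) (rho : R[i]) (k : R -> R[i]) : graph :=
  [set fg |
  [/\ L2 fg.1, L2 fg.2 & exists u du,
    [/\ H1_repr u du, eqae fg.1 u, u 0 = rho * u (2 * pi) &
        eqae fg.2
          (fun x => 'i%C * du x + V x * u x + u (2 * pi) * k x)]]].

End L2.

(* Main.v *)
Require Import Defs.
From mathcomp Require Import all_boot all_order all_algebra.
From mathcomp Require Import all_classical all_reals all_analysis.
From mathcomp Require Import complex.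
From mathcomp Require Import measurable_realfun ring lra.

(** For every [u] in the domain of a dissipative [A] the form
    [Im <u, A u>] is nonnegative. If [A u = lambda u] with [lambda] real, [u]
    minimises this form, so [<u, (A - lambda) g> = 0] for all [g] in the domain.
    Let [E] solve [i E' + (V - lambda) E = 0], [E 0 = 1]. Taking [g = E G] with
    [G] vanishing at both ends gives [int (conj u) E G' = 0] for every [G'] of
    mean zero, so [(conj u) E] is constant. Normalising [u (2 pi) = 1], this
    determines [u] as the solution of [i u' + conj V u = lambda u], and with it
    [rho = u 0] and [k = (conj V - V) u].
    Conversely, for this [rho] and [k], every [f] of the domain satisfies
    [Im <f, A f> = int (Im V) |f - f (2 pi) u|^2 >= 0]. Variation of
    constants shows that a point is either in the resolvent set of
    [A_(rho, k)] or an eigenvalue; hence [-i] is in the resolvent set of a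
    dissipative [A_(rho, k)], which is therefore maximal. *)

Set Implicit Arguments.
Unset Strict Implicit.
Unset Printing Implicit Defensive.

Import Order.TTheory GRing.Theory Num.Theory.
Import numFieldNormedType.Exports.
Local Open Scope classical_set_scope.
Local Open Scope ring_scope.

(** * Real square-integrable functions *)

Section RealL2.
Variable R : realType.
Implicit Types (f g h F G : R -> R) (x y z : R).
Local Notation D := (interval02pi R).
Local Notation mu := (@lebesgue_measure R).
Local Notation c := (2 * pi : R).
Local Notation intg f := (mu.-integrable D (EFin \o f)).
Local Notation mfun f := (@measurable_fun _ _ (measurableTypeR R) R D f).

(** Two obstacles shape the proof. First, elements of H^1 are known only as indefinite integrals of
    L^2 functions. No step differentiates almost everywhere: the product and chain rules come from
    bounding the error on [[x, y]] by [y - x] times an increment of one fixed function, and such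
    errors disappear under subdivision. Secondly, a graph holds functions up to null sets, while
    [rho] and [k] act through the end values of a representative hidden under an existential. These
    values and the derivative must be shown to depend on the class only; for the derivative this
    rests on the density in L^2 of H^1 functions vanishing at both ends. The form is nonnegative
    because [k = - 2 i (Im V) u] supplies exactly the cross term of a square, and the boundary terms
    cancel because [f] and [f (2 pi) u] agree at both ends. The point [- i] is used because
    [Im <f, - i f> = - |f|^2] excludes it as an eigenvalue of any dissipative operator. *)

Lemma measurable_interval02pi : measurable (D : set (measurableTypeR R)). Proof. exact: measurable_itv. Qed.
#[local] Hint Resolve measurable_interval02pi : core.

Lemma two_pi_gt0 : 0 < c. Proof. by rewrite mulr_gt0// pi_gt0. Qed.
#[local] Hint Resolve two_pi_gt0 : core.

Lemma two_pi_ge0 : 0 <= c. Proof. exact: ltW. Qed.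

Lemma lebesgue_interval02pi : mu D = c%:E.
Proof. by rewrite /interval02pi lebesgue_measure_itv/= lte_fin two_pi_gt0 sube0. Qed.

Let sqrN x : x ^+ 2 = `|x| ^+ 2. Proof. by rewrite real_normK ?num_real. Qed.

Definition L2r f := mfun f /\ intg (fun x => f x ^+ 2).

Lemma le_integrable02pi f g : mfun f -> (forall x, D x -> `|f x| <= g x) ->
  intg g -> intg f.
Proof.
move=> mf fg; apply: le_integrable => //; first exact/measurable_EFinP.
by move=> x Dx /=; rewrite lee_fin (le_trans (fg x Dx))// ler_norm.
Qed.

Lemma eq_integrable02pi f g : f =1 g -> intg f -> intg g.
Proof. by move=> /funext->. Qed.

Lemma intgD f g : intg f -> intg g -> intg (fun x => f x + g x).
Proof. by move=> fi gi; have := integrableD measurable_interval02pi fi gi. Qed.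

Lemma intgZ (a : R) f : intg f -> intg (fun x => a * f x).
Proof. by move=> fi; have := integrableZl measurable_interval02pi a fi. Qed.

Lemma intgB f g : intg f -> intg g -> intg (fun x => f x - g x).
Proof. by move=> fi gi; have := integrableB measurable_interval02pi fi gi. Qed.

Lemma intg_cst (a : R) : intg (fun=> a).
Proof.
have := @measurable_bounded_integrable _ _ R mu (cst a) D measurable_interval02pi; apply => //.
  by apply: (@le_lt_trans _ _ c%:E); rewrite ?ltry// -lebesgue_interval02pi.
by exists `|a|; split => // M aM x _ /=; exact: ltW.
Qed.

Lemma intg_meas f : intg f -> mfun f.
Proof. by move=> /(measurable_int mu)/measurable_EFinP. Qed.

Lemma L2r_mul f g : L2r f -> L2r g -> intg (fun x => f x * g x).
Proof.
move=> [mf fi] [mg gi]; apply: (@le_integrable02pi _ (fun x => f x ^+ 2 + g x ^+ 2)).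
- exact: measurable_funM.
- move=> x _; rewrite (sqrN (f x)) (sqrN (g x)) normrM; set a := `|f x|; set b := `|g x|.
  have a0 : 0 <= a by exact: normr_ge0.
  have b0 : 0 <= b by exact: normr_ge0.
  nra.
- exact: intgD.
Qed.

Lemma L2r_intg f : L2r f -> intg f.
Proof.
move=> [mf fi]; apply: (@le_integrable02pi _ (fun x => f x ^+ 2 + 1)) => //.
- by move=> x _; rewrite sqrN; set a := `|f x|; nra.
- by apply: intgD => //; exact: intg_cst.
Qed.

Lemma L2rD f g : L2r f -> L2r g -> L2r (fun x => f x + g x).
Proof.
move=> f2 g2; split; first exact: measurable_funD f2.1 g2.1.
have -> : (fun x => (f x + g x) ^+ 2) =
  (fun x => f x ^+ 2 + (2 * (f x * g x) + g x ^+ 2)).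
  by apply/funext => x; ring.
apply: intgD; first exact: f2.2.
by apply: intgD; [exact/intgZ/L2r_mul | exact: g2.2].
Qed.

Lemma L2rM f g (M : R) : L2r f -> mfun g ->
  (forall x, D x -> `|g x| <= M) -> L2r (fun x => f x * g x).
Proof.
move=> [mf fi] mg gM; split; first exact: measurable_funM.
apply: (@le_integrable02pi _ (fun x => M ^+ 2 * f x ^+ 2)).
- by apply: measurable_funX; exact: measurable_funM.
- move=> x Dx; rewrite ger0_norm ?sqr_ge0// exprMn [leLHS]mulrC.
  apply: ler_wpM2r; first exact: sqr_ge0.
  have M0 : 0 <= M by exact: le_trans (normr_ge0 _) (gM x Dx).
  by rewrite (sqrN (g x)); apply: lerXn2r; rewrite ?nnegrE ?gM.
- exact: intgZ.
Qed.

Lemma L2r_cst (a : R) : L2r (fun=> a).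
Proof. by split; [exact: measurable_cst | exact: intg_cst]. Qed.

Lemma L2rZ (a : R) f : L2r f -> L2r (fun x => a * f x).
Proof.
move=> f2; have := @L2rM f (fun=> a) `|a| f2 (measurable_cst _) (fun _ _ => lexx _).
by under eq_fun do rewrite mulrC.
Qed.

Lemma L2rN f : L2r f -> L2r (fun x => - f x).
Proof. by move=> /(L2rZ (-1)); under eq_fun do rewrite mulN1r. Qed.

Lemma L2rB f g : L2r f -> L2r g -> L2r (fun x => f x - g x).
Proof. by move=> f2 /L2rN; exact: L2rD. Qed.

Lemma L2r_bounded f (M : R) : mfun f ->
  (forall x, D x -> `|f x| <= M) -> L2r f.
Proof.
move=> mf fM; have := @L2rM (fun=> 1) f M (L2r_cst 1) mf fM.
by under eq_fun do rewrite mul1r.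
Qed.

Lemma L2r_le f g : mfun f -> (forall x, D x -> `|f x| <= `|g x|) ->
  L2r g -> L2r f.
Proof.
move=> mf fg [mg gi]; split => //.
apply: (@le_integrable02pi _ (fun x => g x ^+ 2)) => //.
  exact: measurable_funX.
by move=> x Dx; rewrite normrX (sqrN (g x)) lerXn2r ?nnegrE// fg.
Qed.

(** The interval is open so that the components of the integrals in [H1_repr] and [inner] are of
    this form by conversion. *)
Definition Iv x y f : R := \int[mu]_(t in `]x, y[) f t.

Lemma sub_itv_interval02pi x y : 0 <= x -> y <= c -> `]x, y[ `<=` D.
Proof.
move=> x0 yc t /=; rewrite /interval02pi /= !in_itv /= => /andP[xt ty].
by rewrite (le_lt_trans x0 xt) (lt_le_trans ty yc).
Qed.

Lemma intg_sub f x y : 0 <= x -> y <= c -> intg f ->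
  mu.-integrable `]x, y[ (EFin \o f).
Proof.
by move=> x0 yc; apply: integrableS => //; [exact: sub_itv_interval02pi].
Qed.

Lemma IvE f : Iv 0 c f = \int[mu]_(x in D) f x. Proof. by []. Qed.

Lemma Iv_xx f x : Iv x x f = 0.
Proof. by rewrite /Iv set_itv_ge ?bnd_simp ?ltxx// Rintegral_set0. Qed.

Lemma Iv_cat f x y z : intg f -> 0 <= x -> x <= y -> y <= z -> z <= c ->
  Iv x z f = Iv x y f + Iv y z f.
Proof.
move=> fi x0 xy; rewrite le_eqVlt => /predU1P[-> zc|yz zc].
  by rewrite Iv_xx addr0.
(* The point [y] lies in neither open piece; closing the first one at [y] adds only a null set. *)
have e := Rintegral_itv_bndo_bndc (intg_sub x0 (le_trans (ltW yz) zc) fi).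
rewrite /Iv e -(@Rintegral_itvB _ _ _ _ y (intg_sub x0 zc fi)) ?bnd_simp//.
by rewrite [RHS]addrC subrK.
Qed.

Lemma IvD f g x y : intg f -> intg g -> 0 <= x -> y <= c ->
  Iv x y (fun t => f t + g t) = Iv x y f + Iv x y g.
Proof. by move=> fi gi x0 yc; rewrite /Iv RintegralD//; apply: intg_sub. Qed.

Lemma IvB f g x y : intg f -> intg g -> 0 <= x -> y <= c ->
  Iv x y (fun t => f t - g t) = Iv x y f - Iv x y g.
Proof. by move=> fi gi x0 yc; rewrite /Iv RintegralB//; apply: intg_sub. Qed.

Lemma IvZ (a : R) f x y : intg f -> 0 <= x -> y <= c ->
  Iv x y (fun t => a * f t) = a * Iv x y f.
Proof. by move=> fi x0 yc; rewrite /Iv RintegralZl//; apply: intg_sub. Qed.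

Lemma Iv_ge0 f x y : (forall t, x < t < y -> 0 <= f t) -> 0 <= Iv x y f.
Proof. by move=> f0; apply: Rintegral_ge0 => t /=; rewrite in_itv; exact: f0. Qed.

Lemma le_Iv f g x y : intg f -> intg g -> 0 <= x -> y <= c ->
  (forall t, x < t < y -> f t <= g t) -> Iv x y f <= Iv x y g.
Proof.
move=> fi gi x0 yc fg; apply: le_Rintegral => //; try exact: intg_sub.
Qed.

Lemma intg_norm f : intg f -> intg (fun x => `|f x|).
Proof. by move=> fi; have := integrable_norm fi. Qed.

Lemma norm_Iv f x y : intg f -> 0 <= x -> y <= c ->
  `|Iv x y f| <= Iv x y (fun t => `|f t|).
Proof. by move=> fi x0 yc; apply: le_normr_Rintegral => //; exact: intg_sub. Qed.

Lemma Iv_cst (a : R) x y : x <= y -> Iv x y (fun=> a) = a * (y - x).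
Proof.
move=> xy; have e : mu `]x, y[%classic = (y - x)%:E.
  rewrite lebesgue_measure_itv/= lte_fin; case: ltP => [//|yx].
  by rewrite (@le_anti _ _ y x) ?subrr// yx xy.
transitivity (a * fine (mu `]x, y[%classic)); last by rewrite e.
exact: Rintegral_cst.
Qed.

(* Cauchy-Schwarz, from [0 <= int ((y - x) |f| - int |f|)^2]. *)
Lemma Iv_norm_sqr f x y : L2r f -> 0 <= x -> x <= y -> y <= c ->
  Iv x y (fun t => `|f t|) ^+ 2 <= (y - x) * Iv x y (fun t => f t ^+ 2).
Proof.
move=> f2 x0 + yc; rewrite le_eqVlt => /predU1P[->|xy].
  by rewrite !Iv_xx subrr mul0r expr2 mul0r.
have fi := intg_norm (L2r_intg f2).
set a := Iv x y (fun t => `|f t|); set b := Iv x y _.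
have : 0 <= Iv x y (fun t => ((y - x) ^+ 2 * f t ^+ 2 - (2 * (y - x) * a) * `|f t|) + a ^+ 2).
  apply: Iv_ge0 => t _; rewrite -(real_normK (num_real (f t))).
  rewrite [leRHS](_ : _ = ((y - x) * `|f t| - a) ^+ 2) ?sqr_ge0//; ring.
have fi2 : intg (fun t => (y - x) ^+ 2 * f t ^+ 2) by apply: intgZ; exact: f2.2.
have fi1 : intg (fun t => (2 * (y - x) * a) * `|f t|) by exact: intgZ.
have fi3 := intgB fi2 fi1.
rewrite (IvD fi3 (intg_cst (a ^+ 2)) x0 yc) (Iv_cst _ (ltW xy)).
rewrite (IvB fi2 fi1 x0 yc) (IvZ _ f2.2 x0 yc) (IvZ _ fi x0 yc) -/a -/b.
rewrite (_ : _ + _ = (y - x) * ((y - x) * b - a ^+ 2)); last by ring.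
by rewrite pmulr_rge0 ?subr_gt0// subr_ge0.
Qed.

(* Cutting [0, x] into n equal pieces, the bounds telescope to
   [|W x - W 0| <= (x / n) (N x - N 0)]. *)
Lemma const_of_small (W N : R -> R) :
  (forall x y, 0 <= x -> x <= y -> y <= c -> `|W y - W x| <= (y - x) * (N y - N x)) ->
  forall x, 0 <= x <= c -> W x = W 0.
Proof.
move=> WN x /andP[x0 xc].
have step (n : nat) : `|W x - W 0| * n.+1%:R <= x * (N x - N 0).
  pose d := x / n.+1%:R.
  have d0 : 0 <= d by rewrite divr_ge0.
  have dn : d * n.+1%:R = x by rewrite /d divfK.
  have ind (k : nat) : (k <= n.+1)%N ->
      `|W (d * k%:R) - W 0| <= d * (N (d * k%:R) - N 0).
    elim: k => [_|k ih kn]; first by rewrite mulr0 !subrr normr0 mulr0.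
    have kx : d * k.+1%:R <= x by rewrite -dn ler_wpM2l// ler_nat.
    have ke : d * k.+1%:R - d * k%:R = d by rewrite -mulrBr -natrB// subSnn mulr1.
    have := WN (d * k%:R) (d * k.+1%:R) (mulr_ge0 d0 (ler0n _ _)).
    rewrite ke => /(_ _ (le_trans kx xc)).
    rewrite ler_wpM2l ?ler_nat// => /(_ isT) h1.
    have := ih (ltnW kn) => h2.
    rewrite -(subrKA (W (d * k%:R))) (le_trans (ler_normD _ _))//.
    rewrite (_ : d * (N (d * k.+1%:R) - N 0) =
     d * (N (d * k.+1%:R) - N (d * k%:R)) + d * (N (d * k%:R) - N 0)); last by ring.
    exact: lerD.
  have := ind n.+1 (leqnn _); rewrite dn => h.
  by rewrite -ler_pdivlMr// [leRHS]mulrAC.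
apply/eqP; rewrite -subr_eq0 -normr_le0 leNgt; apply/negP => w0.
have [n] : exists n : nat, x * (N x - N 0) < `|W x - W 0| * n.+1%:R.
  have [n hn] : exists n : nat, x * (N x - N 0) / `|W x - W 0| < n.+1%:R.
    set q := _ / _; exists (Num.Def.archi_bound `|q|).
    rewrite (le_lt_trans (ler_norm _))// (lt_le_trans (archi_boundP _))//.
    by rewrite ler_nat.
  by exists n; rewrite [ltRHS]mulrC -ltr_pdivrMr.
by rewrite ltNge step.
Qed.

End RealL2.

(** * Absolutely continuous functions with square-integrable derivative *)

Section AC.
Variable R : realType.
Implicit Types (f g h F G : R -> R) (x y z : R).
Local Notation D := (interval02pi R).
Local Notation mu := (@lebesgue_measure R).
Local Notation c := (2 * pi : R).
Local Notation intg f := (mu.-integrable D (EFin \o f)).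
Local Notation mfun f := (@measurable_fun _ _ (measurableTypeR R) R D f).
#[local] Hint Resolve measurable_interval02pi two_pi_gt0 : core.

(** Real H^1 functions with their derivative. Having [f] in L^2 rather than L^1 lets Cauchy-Schwarz
    bound the square of the integral of [|f|] over [[x, y]] by [y - x] times the integral of
    [f ^ 2]. *)
Definition ac F f := L2r f /\ forall x, 0 <= x <= c -> F x = F 0 + Iv 0 x f.

Lemma ac_incr F f x y : ac F f -> 0 <= x -> x <= y -> y <= c ->
  F y - F x = Iv x y f.
Proof.
move=> [f2 Ff] x0 xy yc.
rewrite (Ff y) ?(le_trans x0 xy)// (Ff x) ?x0 ?(le_trans xy yc)//.
rewrite (Iv_cat (L2r_intg f2) (lexx _) x0 xy yc); ring.
Qed.

Lemma Iv_mono f x y z : intg f -> (forall t, 0 <= f t) -> 0 <= x -> x <= y -> y <= c ->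
  Iv 0 x f <= Iv 0 y f.
Proof.
move=> fi f0 x0 xy yc; rewrite (Iv_cat fi (lexx _) x0 xy yc) lerDl.
by apply: Iv_ge0 => t _.
Qed.

Lemma ac_bounded F f : ac F f -> exists M, forall x, 0 <= x <= c -> `|F x| <= M.
Proof.
move=> acF; exists (`|F 0| + Iv 0 c (fun t => `|f t|)) => x /andP[x0 xc].
have fi := L2r_intg acF.1.
rewrite -[F x](subrK (F 0)) (ac_incr acF (lexx _) x0 xc) addrC.
rewrite (le_trans (ler_normD _ _))// lerD2l.
rewrite (le_trans (norm_Iv fi (lexx _) xc))//.
by apply: Iv_mono => //; exact: intg_norm.
Qed.

Lemma interval02pi_le x : D x -> 0 <= x <= c.
Proof. by rewrite /interval02pi /= in_itv /= => /andP[/ltW-> /ltW->]. Qed.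

Lemma measurable_Iv f : intg f -> (forall t, 0 <= f t) -> mfun (fun x => Iv 0 x f).
Proof.
move=> fi f0.
(* Clamping [x] to [[0, c]] gives a function that is monotone on the whole line and unchanged on the
   interval. *)
apply: (@eq_measurable_fun _ _ _ _ _
    (fun x => Iv 0 (Num.max 0 (Num.min x c)) f)).
  by move=> x; rewrite inE => /interval02pi_le/andP[x0 xc]; rewrite min_l// max_r.
apply: nondecreasing_measurable; first exact: measurable_interval02pi.
move=> x y xy; apply: Iv_mono => //.
- by rewrite le_max lexx.
- rewrite ge_max le_max lexx /= le_max; apply/orP; right.
  by rewrite le_min !ge_min xy lexx orbT.
- by rewrite ge_max two_pi_ge0 /= ge_min lexx orbT.
Qed.

(** Measurability comes from monotonicity: [f] is the difference of the nonnegative functions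
    [f + |f|] and [|f|], whose primitives are nondecreasing. *)
Lemma ac_meas F f : ac F f -> mfun F.
Proof.
move=> [f2 Ff]; have fi := L2r_intg f2; have fn := intg_norm fi.
apply: (@eq_measurable_fun _ _ _ _ _ (fun x => F 0 +
    (Iv 0 x (fun t => f t + `|f t|) - Iv 0 x (fun t => `|f t|)))).
  move=> x; rewrite inE => /interval02pi_le/andP[x0 xc].
  by rewrite IvD// addrK (Ff x) ?x0.
apply: measurable_funD; first exact: measurable_cst.
apply: measurable_funB; apply: measurable_Iv => //; first exact: intgD.
by move=> t; rewrite -lerBlDl sub0r ler_normr lexx orbT.
Qed.

Lemma ac_L2 F f : ac F f -> L2r F.
Proof.
move=> acF; have [M FM] := ac_bounded acF.
by apply: (@L2r_bounded _ _ M) (ac_meas acF) _ => x /interval02pi_le; exact: FM.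
Qed.

Lemma L2r_mul_ac F f g : ac F f -> L2r g -> L2r (fun x => g x * F x).
Proof.
move=> acF g2; have [M FM] := ac_bounded acF.
by apply: (L2rM g2 (ac_meas acF)) => x /interval02pi_le; exact: FM.
Qed.

(** Common source of the product and chain rules: [W] minus the primitive of [w] satisfies the
    hypothesis of [const_of_small]. *)
Lemma ac_of_small (W w N : R -> R) : L2r w ->
  (forall x y, 0 <= x -> x <= y -> y <= c ->
     `|W y - W x - Iv x y w| <= (y - x) * (N y - N x)) ->
  ac W w.
Proof.
move=> w2 WN; split=> // x xc.
have wi := L2r_intg w2.
have := @const_of_small R (fun x => W x - Iv 0 x w) N _ x xc.
rewrite Iv_xx subr0 => <-; first by rewrite subrK.
move=> a b a0 ab bc; rewrite (le_trans _ (WN a b a0 ab bc))//.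
rewrite (Iv_cat wi (lexx _) a0 ab bc) le_eqVlt; apply/orP; left; apply/eqP.
by congr (`| _ |); ring.
Qed.

(** With [a] and [b] the integrals of [|f|] and [|g|] over [[x, y]], the error is at most
    [2 a b <= a^2 + b^2], and Cauchy-Schwarz supplies the factor [y - x]. *)
Lemma ac_mul F f G g : ac F f -> ac G g ->
  ac (fun x => F x * G x) (fun x => f x * G x + g x * F x).
Proof.
move=> acF acG; have [f2 _] := acF; have [g2 _] := acG.
have fG2 := L2r_mul_ac acG f2; have gF2 := L2r_mul_ac acF g2.
have fi := L2r_intg f2; have gi := L2r_intg g2.
have fGi := L2r_intg fG2; have gFi := L2r_intg gF2.
apply: (@ac_of_small _ _ (fun x => Iv 0 x (fun t => f t ^+ 2 + g t ^+ 2))).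
  exact: L2rD.
move=> x y x0 xy yc.
have sq2 : intg (fun t => f t ^+ 2 + g t ^+ 2) by apply: intgD; [exact: f2.2|exact: g2.2].
set a := Iv x y (fun t => `|f t|); set b := Iv x y (fun t => `|g t|).
(* This uses [F y G y - F x G x = G y (F y - F x) + F x (G y - G x)], hence the two different
   endpoints. *)
have -> : F y * G y - F x * G x - Iv x y (fun t => f t * G t + g t * F t) =
    Iv x y (fun t => (G y * f t - f t * G t) + (F x * g t - g t * F t)).
  rewrite IvD// IvD//; [|by apply: intgB => //; exact: intgZ..].
  rewrite !IvB//; [|by apply: intgZ..].
  rewrite !IvZ// -(ac_incr acF x0 xy yc) -(ac_incr acG x0 xy yc); ring.
have small (H k : R -> R) : ac H k -> forall t, x < t < y ->
    `|H y - H t| <= Iv x y (fun t => `|k t|) /\ `|H x - H t| <= Iv x y (fun t => `|k t|).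
  move=> acH t /andP[/ltW xt /ltW ty].
  have ki := intg_norm (L2r_intg acH.1).
  have t0 := le_trans x0 xt; have tc := le_trans ty yc.
  rewrite (Iv_cat ki x0 xt ty yc) (ac_incr acH t0 ty yc).
  rewrite distrC (ac_incr acH x0 xt tc).
  have /= h1 := norm_Iv (L2r_intg acH.1) x0 tc.
  have /= h2 := norm_Iv (L2r_intg acH.1) t0 yc.
  split; first by rewrite (le_trans h2)// lerDr; apply: Iv_ge0.
  by rewrite (le_trans h1)// lerDl; apply: Iv_ge0.
have i1 : intg (fun t => (G y * f t - f t * G t) + (F x * g t - g t * F t)).
  by apply: intgD; apply: intgB => //; exact: intgZ.
rewrite (le_trans (norm_Iv i1 x0 yc))//.
have i2 : intg (fun t => b * `|f t| + a * `|g t|).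
  by apply: intgD; apply: intgZ; exact: intg_norm.
rewrite (@le_trans _ _ (Iv x y (fun t => b * `|f t| + a * `|g t|)))//.
  apply: le_Iv => //; first exact: intg_norm.
  move=> t xty; have [hG _] := small _ _ acG t xty; have [_ hF] := small _ _ acF t xty.
  rewrite (le_trans (ler_normD _ _))//.
  rewrite (_ : G y * f t - f t * G t = (G y - G t) * f t); last by ring.
  rewrite (_ : F x * g t - g t * F t = (F x - F t) * g t); last by ring.
  by rewrite !normrM lerD// ler_wpM2r.
have fn := intg_norm fi; have gn := intg_norm gi.
rewrite IvD ?IvZ//; [|by apply: intgZ..].
rewrite -/a -/b.
have -> : Iv 0 y (fun t => f t ^+ 2 + g t ^+ 2) - Iv 0 x (fun t => f t ^+ 2 + g t ^+ 2)
   = Iv x y (fun t => f t ^+ 2) + Iv x y (fun t => g t ^+ 2).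
  by rewrite (Iv_cat sq2 (lexx _) x0 xy yc) -IvD ?f2.2 ?g2.2// addrAC subrr add0r.
have := Iv_norm_sqr f2 x0 xy yc; have := Iv_norm_sqr g2 x0 xy yc.
rewrite -/a -/b mulrDr => hb ha.
by rewrite (le_trans _ (lerD ha hb))//; have := sqr_ge0 (a - b); nra.
Qed.

Lemma acD F f G g : ac F f -> ac G g ->
  ac (fun x => F x + G x) (fun x => f x + g x).
Proof.
move=> [f2 Ff] [g2 Gg]; split; first exact: L2rD.
move=> x xc; rewrite Ff// Gg// IvD ?(andP xc).2//; [ring|exact: L2r_intg..].
Qed.

Lemma acZ (a : R) F f : ac F f -> ac (fun x => a * F x) (fun x => a * f x).
Proof.
move=> [f2 Ff]; split; first exact: L2rZ.
by move=> x xc; rewrite Ff// IvZ ?(andP xc).2 ?mulrDr//; exact: L2r_intg.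
Qed.

Lemma acN F f : ac F f -> ac (fun x => - F x) (fun x => - f x).
Proof.
move=> /(acZ (-1)); under eq_fun do rewrite mulN1r.
by under [X in ac _ X]eq_fun do rewrite mulN1r.
Qed.

Lemma acB F f G g : ac F f -> ac G g ->
  ac (fun x => F x - G x) (fun x => f x - g x).
Proof. by move=> acF /acN; exact: acD. Qed.

Lemma ac_cst (a : R) : ac (fun=> a) (fun=> 0).
Proof.
split; first exact: L2r_cst.
by move=> x /andP[x0 _]; rewrite Iv_cst// mul0r addr0.
Qed.

Lemma ac_id : ac id (fun=> 1).
Proof.
split; first exact: L2r_cst.
by move=> x /andP[x0 _]; rewrite Iv_cst// mul1r add0r subr0.
Qed.

Lemma ac_Iv f : L2r f -> ac (fun x => Iv 0 x f) f.
Proof. by move=> f2; split=> // x _; rewrite Iv_xx add0r. Qed.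

(** A Taylor estimate at [F x], with an error quadratic in the integral of [|f|] as in the product
    rule. The bound on [ddphi] is asked only where [F] takes its values, since the exponential has
    no global one. *)
Lemma ac_comp (phi dphi ddphi : R -> R) F f (L K : R) :
  (forall x, is_derive x 1 phi (dphi x)) ->
  (forall x, is_derive x 1 dphi (ddphi x)) ->
  (forall x, 0 <= x <= c -> `|F x| <= K) ->
  (forall p, `|p| <= K -> `|ddphi p| <= L) ->
  ac F f -> ac (fun x => phi (F x)) (fun x => f x * dphi (F x)).
Proof.
move=> dp ddp FK Lb acF; have [f2 _] := acF; have fi := L2r_intg f2.
have K0 : 0 <= K.
  by apply: le_trans (FK 0 _); rewrite ?lexx ?two_pi_ge0.
have L0 : 0 <= L by apply: le_trans (Lb 0 _); rewrite ?normr0.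
have lip p q : `|p| <= K -> `|q| <= K -> `|dphi q - dphi p| <= L * `|q - p|.
  wlog pq : p q / p <= q => [wl hp hq|].
    have [/wl|/ltW/wl] := leP p q; first exact.
    by rewrite distrC (distrC p q); exact.
  move=> hp hq; have [|r /[!in_itv]/= /andP[pr rq] ->] := @MVT_segment R dphi ddphi p q pq.
    by apply: continuous_subspaceT => z; apply: differentiable_continuous;
      apply/derivable1_diffP; exact: ex_derive.
  rewrite normrM ler_wpM2r//; apply: Lb.
  by move: hp hq; rewrite !ler_norml => /andP[? ?] /andP[? ?]; apply/andP; split; lra.
(* Two uses of the mean value theorem give [L] instead of the sharp [L / 2], which is enough. *)
have tay p q : `|p| <= K -> `|q| <= K ->
    `|phi q - phi p - dphi p * (q - p)| <= L * `|q - p| ^+ 2.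
  move=> hp hq.
  have cphi : continuous phi.
    by move=> z; apply: differentiable_continuous;
      apply/derivable1_diffP; exact: ex_derive.
  suff [r [rK rpq ->]] : exists r, [/\ `|r| <= K, `|r - p| <= `|q - p| &
      phi q - phi p = dphi r * (q - p)].
    rewrite -mulrBl normrM expr2 mulrA ler_wpM2r//.
    by rewrite (le_trans (lip _ _ hp rK))// ler_wpM2l.
  have [pq|/ltW qp] := leP p q.
    have [|r /[!in_itv]/= /andP[pr rq] e] := @MVT_segment R phi dphi p q pq.
      exact: continuous_subspaceT.
    exists r; split => //; last by rewrite !ger0_norm ?subr_ge0 ?lerB//.
    by move: hp hq; rewrite !ler_norml => /andP[? ?] /andP[? ?]; apply/andP; split; lra.
  have [|r /[!in_itv]/= /andP[pr rq] e] := @MVT_segment R phi dphi q p qp.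
    exact: continuous_subspaceT.
  exists r; split; last by rewrite -opprB e; ring.
    by move: hp hq; rewrite !ler_norml => /andP[? ?] /andP[? ?]; apply/andP; split; lra.
  by rewrite distrC (distrC q) !ger0_norm ?subr_ge0// lerB.
have mdphiF : mfun (fun x => dphi (F x)).
  have mdphi : measurable_fun [set: R] dphi.
    apply: continuous_measurable_fun => z; apply: differentiable_continuous.
    by apply/derivable1_diffP; exact: ex_derive.
  exact: (measurableT_comp mdphi (ac_meas acF)).
have w2 : L2r (fun x => f x * dphi (F x)).
  apply: (@L2rM _ _ _ (`|dphi 0| + L * K) f2 mdphiF) => x /interval02pi_le xc.
  rewrite -(subrK (dphi 0) (dphi (F x))) addrC (le_trans (ler_normD _ _))// lerD2l.
  rewrite (le_trans (lip _ _ _ (FK x xc)))// ?normr0// subr0 ler_wpM2l//; exact: FK.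
(* One [L] pays for the Taylor remainder at [F x], the other for replacing [dphi (F t)] by
   [dphi (F x)] under the integral. *)
apply: (@ac_of_small _ _ (fun x => (L + L) * Iv 0 x (fun t => f t ^+ 2))) => // x y x0 xy yc.
have wi := L2r_intg w2.
have fn := intg_norm fi.
set a := Iv x y (fun t => `|f t|).
have Fx : `|F x| <= K by apply: FK; rewrite x0 (le_trans xy).
have Fy : `|F y| <= K by apply: FK; rewrite yc (le_trans x0).
have a0 : 0 <= a by apply: Iv_ge0.
have Fa t : x <= t -> t <= y -> `|F t - F x| <= a.
  move=> xt ty; rewrite (ac_incr acF x0 xt (le_trans ty yc)).
  rewrite (le_trans (norm_Iv fi x0 (le_trans ty yc)))// /a (Iv_cat fn x0 xt ty yc).
  by rewrite lerDl; apply: Iv_ge0.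
have -> : phi (F y) - phi (F x) - Iv x y (fun t => f t * dphi (F t)) =
   (phi (F y) - phi (F x) - dphi (F x) * (F y - F x)) +
   Iv x y (fun t => dphi (F x) * f t - f t * dphi (F t)).
  rewrite IvB ?IvZ//; last exact: intgZ.
  by rewrite (ac_incr acF x0 xy yc); ring.
have i1 : intg (fun t => dphi (F x) * f t - f t * dphi (F t)).
  by apply: intgB => //; exact: intgZ.
have h1 := tay _ _ Fx Fy.
have h2 : L * `|F y - F x| ^+ 2 <= L * a ^+ 2.
  by rewrite ler_wpM2l// lerXn2r ?nnegrE// Fa.
have h3 : `|Iv x y (fun t => dphi (F x) * f t - f t * dphi (F t))| <= L * a ^+ 2.
  rewrite (le_trans (norm_Iv i1 x0 yc))//.
  rewrite (_ : L * a ^+ 2 = (L * a) * a); last by ring.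
  rewrite -IvZ//; apply: le_Iv => //; [exact: intg_norm|exact: intgZ|].
  move=> t /andP[/ltW xt /ltW ty].
  rewrite (_ : dphi (F x) * f t - f t * dphi (F t) = (dphi (F x) - dphi (F t)) * f t);
    last by ring.
  rewrite normrM ler_wpM2r// distrC.
  have Ft : `|F t| <= K.
    by apply: FK; rewrite (le_trans x0 xt) (le_trans ty yc).
  rewrite (le_trans (lip _ _ Fx Ft))// ler_wpM2l//; exact: Fa.
have h4 : L * a ^+ 2 <= L * ((y - x) * Iv x y (fun t => f t ^+ 2)).
  by rewrite ler_wpM2l//; exact: Iv_norm_sqr.
rewrite (le_trans (ler_normD _ _))//.
rewrite (Iv_cat f2.2 (lexx _) x0 xy yc).
lra.
Qed.

Lemma ac_exp F f : ac F f -> ac (fun x => expR (F x)) (fun x => f x * expR (F x)).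
Proof.
move=> acF; have [K FK] := ac_bounded acF.
apply: (@ac_comp _ _ expR _ _ (expR K) K _ _ FK _ acF) => p pK.
 rewrite ger0_norm ?expR_ge0// ler_expR.
exact: le_trans (ler_norm _) pK.
Qed.

Lemma ac_sin F f : ac F f -> ac (fun x => sin (F x)) (fun x => f x * cos (F x)).
Proof.
move=> acF; have [K FK] := ac_bounded acF.
apply: (@ac_comp _ _ (fun x => - sin x) _ _ 1 K _ _ FK _ acF) => p.
by move=> _; rewrite normrN ler_norml sin_geN1 sin_le1.
Qed.

Lemma ac_cos F f : ac F f -> ac (fun x => cos (F x)) (fun x => f x * - sin (F x)).
Proof.
move=> acF; have [K FK] := ac_bounded acF.
apply: (@ac_comp _ (fun x => - sin x) (fun x => - cos x) _ _ 1 K _ _ FK _ acF) => p.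
by move=> _; rewrite normrN ler_norml cos_geN1 cos_le1.
Qed.

End AC.

(** * Density in L^2 and uniqueness of derivatives *)

Section Density.
Variable R : realType.
Implicit Types (f g h F G : R -> R) (x y z : R).
Local Notation D := (interval02pi R).
Local Notation mu := (@lebesgue_measure R).
Local Notation c := (2 * pi : R).
Local Notation intg f := (mu.-integrable D (EFin \o f)).
Local Notation mfun f := (@measurable_fun _ _ (measurableTypeR R) R D f).
#[local] Hint Resolve measurable_interval02pi two_pi_gt0 two_pi_ge0 : core.

Lemma sqdist_dominated (h : R -> R) (hn : nat -> R -> R) (B : R -> R) (e : R) :
  0 < e -> mfun h -> (forall n, mfun (hn n)) -> intg B ->
  (forall n x, D x -> (h x - hn n x) ^+ 2 <= B x) ->
  (forall x, D x -> hn n x @[n --> \oo] --> h x) ->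
  exists n, \int[mu]_(x in D) (h x - hn n x) ^+ 2 < e.
Proof.
move=> e0 mh mhn Bi hB hcvg.
have [] := @dominated_convergence _ _ _ mu D (@measurable_interval02pi R)
  (fun n x => ((h x - hn n x) ^+ 2)%:E) (fun=> 0%E) (EFin \o B).
- by move=> n; apply/measurable_EFinP; apply: measurable_funX; exact: measurable_funB.
- exact: measurable_cst.
- apply: aeW => x Dx; apply: cvg_EFin.
    by apply: nearW.
  have : ((h x - hn n x) ^+ 2) @[n --> \oo] --> (h x - h x) ^+ 2.
    apply: cvgM; apply: cvgB; try exact: cvg_cst; exact: hcvg.
  by rewrite subrr expr2 mul0r.
- exact: Bi.
- by apply: aeW => x n Dx; rewrite /= lee_fin ger0_norm ?sqr_ge0// hB.
move=> _ _; rewrite integral0 => /fine_cvgP[_].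
move=> /cvgrPdist_lt /(_ _ e0) [n _ /(_ n (leqnn n))] /=.
rewrite sub0r normrN ger0_norm; first by exists n.
by apply: fine_ge0; apply: integral_ge0 => x _; rewrite lee_fin sqr_ge0.
Qed.

Lemma ac_C1 F f (M : R) : (forall x, 0 <= x <= c -> is_derive x 1 F (f x)) ->
  continuous f -> (forall x, `|f x| <= M) -> ac F f.
Proof.
move=> dF cf fM.
have f2 : L2r f.
  apply: (@L2r_bounded _ _ M) => //.
  by apply: (measurable_funTS); exact: continuous_measurable_fun.
split=> // x /andP[]; rewrite le_eqVlt => /predU1P[<- _|x0 xc].
  by rewrite Iv_xx addr0.
have fi := L2r_intg f2.
have cF z : 0 <= z <= c -> F @ z --> F z.
  move=> zc; apply: differentiable_continuous; apply/derivable1_diffP.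
  by have dz := dF z zc; exact: ex_derive.
have := @continuous_FTC2 R f F 0 x x0.
have -> : Iv 0 x f = \int[mu]_(t in `[0, x]) f t.
  rewrite /Iv -Rintegral_itv_obnd_cbnd ?Rintegral_itv_bndo_bndc//.
    exact: intg_sub.
  have := continuous_compact_integrable (@segment_compact R 0 x).
  move=> /(_ f)h; apply: integrableS (h _) => //.
    by apply: subset_itvr; rewrite bnd_simp.
  exact: continuous_subspaceT.
rewrite /Rintegral => ->.
- by rewrite -EFinB /= subrKC.
- exact: continuous_subspaceT.
- split.
  + move=> z; rewrite in_itv /= => /andP[z0 zx].
    have := dF z; rewrite (ltW z0) (le_trans (ltW zx) xc) => /(_ isT) dz.
    exact: ex_derive.
  + by apply: cvg_at_right_filter; apply: cF; rewrite lexx two_pi_ge0.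
  + by apply: cvg_at_left_filter; apply: cF; rewrite (ltW x0) xc.
- move=> z; rewrite in_itv /= => /andP[z0 zx].
  have := dF z; rewrite (ltW z0) (le_trans (ltW zx) xc) => /(_ isT) dz.
  by rewrite derive1E; exact: derive_val.
Qed.

(** It vanishes at both ends, has values in [[0, 1]] on the closed interval and tends to 1 inside.
    As a power of an exponential of a polynomial it is covered by the rules already proved. *)
Definition cutoff (n : nat) x := 1 - expR (- (x * (c - x))) ^+ n.

Lemma ac_exprn F f n : ac F f -> exists f', ac (fun x => F x ^+ n) f'.
Proof.
move=> acF; elim: n => [|n [f' acF']]; first by eexists; exact: ac_cst.
by eexists; under eq_fun do rewrite exprS; exact: (ac_mul acF acF').
Qed.

Lemma ac_cutoff n : exists f, ac (cutoff n) f.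
Proof.
have ac1 := acN (ac_mul (ac_id R) (acB (ac_cst c) (ac_id R))).
have [f acf] := ac_exprn n (ac_exp ac1).
by eexists; apply: (acB (ac_cst 1) acf).
Qed.

Lemma cutoff0 n : cutoff n 0 = 0.
Proof. by rewrite /cutoff mul0r oppr0 expR0 expr1n subrr. Qed.

Lemma cutoffc n : cutoff n c = 0.
Proof. by rewrite /cutoff subrr mulr0 oppr0 expR0 expr1n subrr. Qed.

Lemma cutoff_le1 n x : 0 <= x <= c -> `|cutoff n x| <= 1.
Proof.
move=> /andP[x0 xc]; rewrite /cutoff.
have e1 : expR (- (x * (c - x))) <= 1.
  by rewrite -[leRHS]expR0 ler_expR oppr_le0 mulr_ge0// subr_ge0.
have e0 := expR_ge0 (- (x * (c - x))).
have := exprn_ile1 n e0 e1; have := exprn_ge0 n e0.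
set q := _ ^+ n => q0 q1; rewrite ler_norml; apply/andP; split; lra.
Qed.

Lemma cvg_cutoff x : D x -> cutoff n x @[n --> \oo] --> (1 : R).
Proof.
rewrite /interval02pi /= in_itv /= => /andP[x0 xc].
have : (1 - expR (- (x * (c - x))) ^+ n) @[n --> \oo] --> (1 - 0 : R).
  apply: cvgB; first exact: cvg_cst.
  apply: cvg_expr; rewrite ger0_norm ?expR_ge0//.
  by rewrite -[ltRHS]expR0 ltr_expR oppr_lt0 mulr_gt0// subr_gt0.
by rewrite subr0.
Qed.

(** * Truncation and approximation in L^2 *)

Definition clip (M x : R) := Num.max (- M) (Num.min M x).

Lemma clip_norm (M x : R) : 0 <= M -> `|clip M x| <= M.
Proof.
move=> M0; rewrite ler_norml /clip le_max lexx /= ge_max ge_min lexx /= andbT.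
by rewrite (le_trans _ M0)// oppr_le0.
Qed.

Lemma clip_id (M x : R) : `|x| <= M -> clip M x = x.
Proof. by rewrite ler_norml => /andP[h1 h3]; rewrite /clip min_r// max_r. Qed.

Lemma clip_dist (M x y : R) : `|x| <= M -> `|x - clip M y| <= `|x - y|.
Proof.
rewrite ler_norml => /andP[h1 h2]; rewrite /clip /Order.min /Order.max.
have := ler_norm (x - y); have := ler_norm (y - x); rewrite (distrC y).
set q := `|x - y| => q1 q2.
by case: (ltP M y) => a1; case: ltP => a2; rewrite ler_norml; apply/andP; split; lra.
Qed.

Lemma clip_dist0 (M x : R) : 0 <= M -> `|x - clip M x| <= `|x|.
Proof.
move=> M0; rewrite /clip /Order.min /Order.max.
have := ler_norm x; have := ler_norm (- x); rewrite normrN.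
set q := `|x| => q1 q2.
by case: (ltP M x) => a1; case: ltP => a2; rewrite ler_norml; apply/andP; split; lra.
Qed.

(* The approximants are difference quotients of a primitive of [g], multiplied by
   a cutoff to make them vanish at the ends. *)
Lemma approx_continuous g (M e : R) : continuous g -> (forall x, `|g x| <= M) -> 0 < e ->
  exists F f, [/\ ac F f, F 0 = 0, F c = 0 & \int[mu]_(x in D) (g x - F x) ^+ 2 < e].
Proof.
move=> cg gM e0.
have M0 : 0 <= M by apply: le_trans (gM 0).
(* The primitive starts at [-1] so that it is differentiable at [0] as well. *)
pose G y : R := \int[mu]_(t in `[-1, y]) g t.
have dG y : -1 < y -> is_derive y 1 G (g y).
  move=> y1; have yy1 : y < y + 1 by rewrite ltrDl.
  have gi : mu.-integrable `[-1, y + 1] (EFin \o g).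
    apply: continuous_compact_integrable; first exact: segment_compact.
    exact: continuous_subspaceT.
  have [dGy Gy] := @continuous_FTC1_closed R g (-1) y (y + 1) yy1 gi y1 (cg y).
  by apply: DeriveDef; [exact: dGy|rewrite -derive1E].
pose d n : R := n.+1%:R^-1.
have d0 n : 0 < d n by rewrite invr_gt0.
pose u n x : R := (d n)^-1 * (G (x + d n) - G x).
have du n x : 0 <= x <= c -> is_derive x 1 (u n) ((d n)^-1 * (g (x + d n) - g x)).
  move=> /andP[x0 xc].
  have x1 : -1 < x by rewrite (lt_le_trans _ x0)// ltrN10.
  have xd1 : -1 < x + d n by rewrite (lt_trans x1)// ltrDl.
  have h1 := dG _ x1; have h2 := dG _ xd1.
  have h3 : is_derive x 1 (fun t : R => G (t + d n)) (g (x + d n)).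
    have h4 : is_derive x 1 (fun t : R => t + d n) 1.
      by apply: is_derive_eq; rewrite addr0.
    have := @is_derive1_comp R G (fun t : R => t + d n) x _ _ h2 h4.
    by rewrite mulr1.
  have h5 := is_deriveB h3 h1.
  have := is_deriveZ ((d n)^-1) h5; exact.
(* By the mean value theorem the difference quotient is a value of [g] nearby, which gives both the
   bound [M] and the pointwise limit. *)
have ug n x : 0 <= x <= c -> exists y, [/\ x <= y, y <= x + d n & u n x = g y].
  move=> /andP[x0 xc].
  have x1 : -1 < x by rewrite (lt_le_trans _ x0)// ltrN10.
  have xd : x <= x + d n by rewrite lerDl ltW.
  have [z|z|y] := @MVT_segment R G g x (x + d n) xd.
  - by rewrite in_itv /= => /andP[xz _]; apply: dG; exact: lt_trans xz.
  - apply/continuous_in_subspaceT => t; rewrite inE /= in_itv /= => /andP[xt _].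
    apply: differentiable_continuous; apply/derivable1_diffP.
    by have dt := dG t (lt_le_trans x1 xt); exact: ex_derive.
  rewrite in_itv /= => /andP[xy yd] Gxy; exists y; split => //.
  by rewrite /u Gxy (addrC x) addrK mulrC mulfK// gt_eqF.
have acu n : ac (u n) (fun x => (d n)^-1 * (g (x + d n) - g x)).
  apply: (@ac_C1 _ _ ((d n)^-1 * (M + M))) => //.
    - move=> x; apply: cvgM; first exact: cvg_cst.
      apply: cvgB; last exact: cg.
      apply: (@continuous_comp _ _ _ (fun t : R => t + d n) g); last exact: cg.
      by apply: cvgD; [exact: cvg_id|exact: cvg_cst].
    - have di0 : 0 <= (d n)^-1 by rewrite invr_ge0 ltW.
      move=> x; rewrite normrM (ger0_norm di0) ler_wpM2l//.
      by rewrite (le_trans (ler_normB _ _))// lerD.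
have uM n x : 0 <= x <= c -> `|u n x| <= M.
  by move=> /ug -/(_ n)[y [_ _ ->]].
have mF n : mfun (fun x => u n x * cutoff n x).
  have [f acf] := ac_cutoff n.
  by apply: measurable_funM; [exact: ac_meas (acu n)|exact: ac_meas acf].
have mg : mfun g by apply: measurable_funTS; exact: continuous_measurable_fun.
have [] := @sqdist_dominated g (fun n x => u n x * cutoff n x) (fun=> (M + M) ^+ 2) e e0 mg mF.
- exact: intg_cst.
- move=> n x /interval02pi_le xc; rewrite -[leLHS]real_normK ?num_real//.
  rewrite lerXn2r ?nnegrE ?addr_ge0// (le_trans (ler_normB _ _))// lerD//.
  by rewrite normrM -[leRHS]mulr1 ler_pM// ?uM// cutoff_le1.
- move=> x Dx; rewrite -[g x]mulr1; apply: cvgM; last exact: cvg_cutoff.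
  apply/cvgrPdist_lt => eps eps0.
  have /cvgrPdist_lt /(_ _ eps0) := cg x.
  move=> [r /= r0 hr].
  have [N] : exists N : nat, r^-1 < N.+1%:R.
    exists (Num.Def.archi_bound r^-1).
    rewrite (lt_trans (archi_boundP _)) ?invr_ge0 ?ltW//.
    by rewrite ltr_nat.
  move=> hN; exists N => // n /= Nn.
  have [y [xy yd ->]] := ug n x (interval02pi_le Dx).
  apply: hr; rewrite /ball_ /= distrC ger0_norm ?subr_ge0//.
  rewrite ltrBlDl (le_lt_trans yd)// ltrD2l /d.
  rewrite invf_plt ?posrE// (lt_le_trans hN)// ler_nat//.
move=> n hn; have [f acf] := ac_cutoff n.
exists (fun x => u n x * cutoff n x); eexists; split => //.
- exact: (ac_mul (acu n) acf).
- by rewrite cutoff0 mulr0.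
- by rewrite cutoffc mulr0.
Qed.

Lemma sqdist_tri f g h : L2r f -> L2r g -> L2r h ->
  \int[mu]_(x in D) (f x - h x) ^+ 2 <=
  2 * \int[mu]_(x in D) (f x - g x) ^+ 2 + 2 * \int[mu]_(x in D) (g x - h x) ^+ 2.
Proof.
move=> f2 g2 h2; rewrite -!IvE.
have i1 := (L2rB f2 g2).2; have i2 := (L2rB g2 h2).2; have i3 := (L2rB f2 h2).2.
rewrite -IvZ// -[X in _ + X]IvZ// -IvD ?intgZ//.
apply: le_Iv => //; first by apply: intgD; exact: intgZ.
move=> t _; have := sqr_ge0 ((f t - g t) - (g t - h t)); nra.
Qed.

(** Starts from density of continuous functions in L^1. Clipping the approximant to [[-M, M]] keeps
    [|h - g| <= 2 M], so the squared L^2 distance is at most [2 M] times the L^1 distance. *)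
Lemma approx_bounded h (M e : R) : mfun h -> (forall x, D x -> `|h x| <= M) -> 0 < e ->
  exists F f, [/\ ac F f, F 0 = 0, F c = 0 & \int[mu]_(x in D) (h x - F x) ^+ 2 < e].
Proof.
move=> mh hM e0.
have h2 : L2r h by exact: L2r_bounded hM.
have M0 : 0 <= M.
  have /hM : D pi by rewrite /interval02pi /= in_itv /= pi_gt0 ltr_pMl ?pi_gt0// ltr1n.
  exact: le_trans.
have muDoo : (mu D < +oo)%E by rewrite lebesgue_interval02pi ltry.
have [g_ [cg gi hg]] := approximation_continuous_integrable (@measurable_interval02pi R) muDoo (L2r_intg h2).
(* The summand 1 avoids a zero denominator when [M = 0]; the quarter allows for the factor 2 in
   [sqdist_tri]. *)
pose r : R := e / 4 / (M + M + 1).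
have r0 : 0 < r by rewrite !divr_gt0//; lra.
move: hg => /fine_cvgP[fi] /cvgrPdist_lt /(_ _ r0) [n _ /(_ n (leqnn n))] /=.
rewrite sub0r normrN => hn.
have {}hn : \int[mu]_(x in D) `|h x - g_ n x| < r by apply: le_lt_trans hn; exact: ler_norm.
pose g x := clip M (g_ n x).
have cg' : continuous g.
  move=> x; apply: (@continuous_max R R (cst (- M)) (fun x => Num.min M (g_ n x))).
    exact: cst_continuous.
  by apply: (@continuous_min R R (cst M) (g_ n)); [exact: cst_continuous|exact: cg].
have gM x : `|g x| <= M by exact: clip_norm.
have hgle x : D x -> `|h x - g x| <= `|h x - g_ n x|.
  by move=> /hM hx; exact: clip_dist.
have mg : mfun g by apply: measurable_funTS; exact: continuous_measurable_fun.
have g2 : L2r g by apply: (@L2r_bounded _ _ M).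
have i1 := (L2rB h2 g2).2.
have ign := intg_norm (intgB (L2r_intg h2) (gi n)).
have hgr : \int[mu]_(x in D) (h x - g x) ^+ 2 < e / 4.
  apply: (@le_lt_trans _ _ ((M + M + 1) * Iv 0 c (fun x => `|h x - g_ n x|))).
    rewrite -IvE -IvZ//; apply: le_Iv => //; first exact: intgZ.
    move=> t tD; have Dt : D t by rewrite /interval02pi /= in_itv.
    rewrite -[leLHS]real_normK ?num_real// expr2 ler_pM// ?hgle//.
    rewrite (le_trans (ler_normB _ _))// (le_trans (lerD (hM t Dt) (gM t)))//.
    by rewrite lerDl.
  by rewrite mulrC -ltr_pdivlMr//; lra.
have e4 : 0 < e / 4 by rewrite divr_gt0.
have [F [f [acF F0 Fc Fg]]] := approx_continuous cg' gM e4.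
exists F, f; split => //.
have := sqdist_tri h2 g2 (ac_L2 acF); lra.
Qed.

Lemma approx_L2 h (e : R) : L2r h -> 0 < e ->
  exists F f, [/\ ac F f, F 0 = 0, F c = 0 & \int[mu]_(x in D) (h x - F x) ^+ 2 < e].
Proof.
move=> h2 e0.
pose hn n x : R := clip n%:R (h x).
have mhn n : mfun (hn n).
  apply: measurable_maxr; first exact: measurable_cst.
  by apply: measurable_minr; [exact: measurable_cst|exact: h2.1].
have hnle n x : `|hn n x| <= n%:R by exact: clip_norm.
have e4 : 0 < e / 4 by rewrite divr_gt0.
have [] := @sqdist_dominated h hn (fun x => h x ^+ 2) _ e4 h2.1 mhn h2.2.
- move=> n x _; rewrite -[leLHS]real_normK ?num_real// -[leRHS]real_normK ?num_real//.
  by apply: lerXn2r; rewrite ?nnegrE//; exact: clip_dist0.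
- move=> x _; apply/cvgrPdist_lt => eps eps0.
  exists (Num.Def.archi_bound `|h x|) => // n /= hN.
  rewrite /hn clip_id ?subrr ?normr0//.
  by rewrite (le_trans (ltW (archi_boundP _)))// ler_nat.
move=> n hn4.
have [F [f [acF F0 Fc Fg]]] := approx_bounded (mhn n) (fun x _ => hnle n x) e4.
have hn2 : L2r (hn n) by exact: L2r_bounded (fun x _ => hnle n x).
exists F, f; split => //.
have := sqdist_tri h2 hn2 (ac_L2 acF); lra.
Qed.

(** * Null sets: representatives and derivatives are determined by their classes *)

Lemma eq_Iv_ae f g x y : mfun f -> mfun g -> ae_eq mu D f g ->
  0 <= x -> y <= c -> Iv x y f = Iv x y g.
Proof.
move=> mf mg fg x0 yc; rewrite /Iv /Rintegral; congr fine.
apply: ae_eq_integral => //.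
- by apply/measurable_EFinP; apply: measurable_funS mf => //; exact: sub_itv_interval02pi.
- by apply/measurable_EFinP; apply: measurable_funS mg => //; exact: sub_itv_interval02pi.
- move: fg; apply: filterS => t h /(sub_itv_interval02pi x0 yc) Dt /=.
  by rewrite h.
Qed.

Lemma int_sqr_eq0 f : L2r f -> \int[mu]_(x in D) f x ^+ 2 = 0 ->
  ae_eq mu D f (fun=> 0).
Proof.
move=> [mf fi] f0.
have h0 : (\int[mu]_(x in D) `|(f x ^+ 2)%:E| = 0)%E.
  under eq_integral do rewrite gee0_abs ?lee_fin ?sqr_ge0//.
  have := integrable_fin_num (@measurable_interval02pi R) fi.
  by move: f0; rewrite /Rintegral /= => f0 /fineK <-; rewrite f0.
have mf2 : @measurable_fun _ _ (measurableTypeR R) _ D (fun x => (f x ^+ 2)%:E).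
  by apply/measurable_EFinP; exact: measurable_funX.
move/(ae_eq_integral_abs _ (@measurable_interval02pi R) mf2): h0; apply: filterS => t h /h /= [].
by move=> /eqP; rewrite sqrf_eq0 => /eqP.
Qed.

(* [H ^ 2] has derivative [2 h H], which vanishes a.e., so it is constant. *)
Lemma ac_eq0 H h : ac H h -> ae_eq mu D H (fun=> 0) ->
  forall x, 0 <= x <= c -> H x = 0.
Proof.
move=> acH H0.
have acH2 := ac_mul acH acH.
have H2i := ac_L2 acH2.
have z0 x : 0 <= x <= c -> H x * H x = H 0 * H 0.
  move=> xc; rewrite (acH2.2 x xc); have /andP[x0 xc'] := xc.
  rewrite (@eq_Iv_ae _ (fun=> 0)) ?Iv_cst ?mul0r ?addr0//.
  - exact: acH2.1.1.
  - by move: H0; apply: filterS => t h0 /h0 ->; rewrite !mulr0 addr0.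
have : Iv 0 c (fun x => H x * H x) = 0.
  rewrite (@eq_Iv_ae _ (fun=> 0)) ?Iv_cst ?mul0r//.
  - exact: two_pi_ge0.
  - exact: H2i.1.
  - by move: H0; apply: filterS => t h0 /h0 ->; rewrite !mulr0.
rewrite (_ : Iv 0 c _ = Iv 0 c (fun=> H 0 * H 0)); last first.
  apply: eq_Rintegral => t; rewrite inE /= in_itv /= => /andP[/ltW t0 /ltW tc].
  by apply: z0; rewrite t0.
rewrite (Iv_cst _ (two_pi_ge0 R)) subr0 => /eqP; rewrite mulf_eq0 (gt_eqF (two_pi_gt0 R)) orbF => /eqP H00.
by move=> x /z0; rewrite H00 => /eqP; rewrite mulf_eq0 orbb => /eqP.
Qed.

(* [d] is orthogonal to every [F] vanishing at both ends, so
   [int d^2 <= int (d - F)^2], and the right-hand side can be made small. *)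
Lemma ac_deriv0 W d : ac W d -> (forall x, 0 <= x <= c -> W x = 0) ->
  ae_eq mu D d (fun=> 0).
Proof.
move=> acW W0; have [d2 _] := acW.
apply: int_sqr_eq0 => //; apply/eqP; rewrite eq_le; apply/andP; split; last first.
  by apply: Rintegral_ge0 => x _; exact: sqr_ge0.
apply/ler_addgt0Pr => e e0; rewrite add0r; have [F [f [acF F0 Fc dF]]] := approx_L2 d2 e0.
apply: le_trans (ltW dF).
have acWF := ac_mul acW acF.
have fW2 := L2r_mul_ac acW acF.1.
have dF2 := L2r_mul_ac acF d2.
(* Integration by parts: the boundary terms vanish with [F], the remaining integral with [W]. *)
have : Iv 0 c (fun x => d x * F x) = 0.
  have := acWF.2 c; rewrite lexx two_pi_ge0 => /(_ isT).
  rewrite Fc F0 !mulr0 add0r IvD//; [|exact: L2r_intg..].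
  have -> : Iv 0 c (fun x => f x * W x) = Iv 0 c (fun=> 0).
    apply: eq_Rintegral => t; rewrite inE /= in_itv /= => /andP[/ltW t0 /ltW tc].
    by rewrite W0 ?mulr0// t0.
  by rewrite (Iv_cst _ (two_pi_ge0 R)) mul0r addr0 => <-.
rewrite -!IvE => dF0.
have i1 := L2r_intg dF2.
have i2 := d2.2; have i3 := (ac_L2 acF).2.
rewrite (_ : Iv 0 c (fun x => (d x - F x) ^+ 2) =
   Iv 0 c (fun x => (d x ^+ 2 + F x ^+ 2) - 2 * (d x * F x))); last first.
  by apply: eq_Rintegral => t _; ring.
rewrite IvB ?IvZ ?IvD ?dF0//; [|exact: intgD|exact: intgZ].
by rewrite mulr0 subr0 lerDl; apply: Iv_ge0 => t _; exact: sqr_ge0.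
Qed.

End Density.

(** * Complex-valued functions *)

Section ComplexL2.
Variable R : realType.
Local Notation Re := (@complex.Re R).
Local Notation Im := (@complex.Im R).
Local Notation normc := ComplexField.Normc.normc.
Local Notation D := (interval02pi R).
Local Notation mu := (@lebesgue_measure R).
Local Notation c := (2 * pi : R).
Local Notation intg f := (mu.-integrable D (EFin \o f)).
Local Notation mfun f := (@measurable_fun _ _ (measurableTypeR R) R D f).
Implicit Types (f g h u v du dv k : R -> R[i]) (x y : R) (a b z w : R[i]).

Lemma ReD a b : Re (a + b) = Re a + Re b. Proof. by case: a b => ? ? []. Qed.
Lemma ImD a b : Im (a + b) = Im a + Im b. Proof. by case: a b => ? ? []. Qed.
Lemma ReN a : Re (- a) = - Re a. Proof. by case: a. Qed.
Lemma ImN a : Im (- a) = - Im a. Proof. by case: a. Qed.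
Lemma ReM a b : Re (a * b) = Re a * Re b - Im a * Im b. Proof. by case: a b => ? ? []. Qed.
Lemma ImM a b : Im (a * b) = Re a * Im b + Im a * Re b. Proof. by case: a b => ? ? []. Qed.
Lemma ReJ a : Re (conjc a) = Re a. Proof. by case: a. Qed.
Lemma ImJ a : Im (conjc a) = - Im a. Proof. by case: a. Qed.
Definition ReImE := (ReD, ImD, ReN, ImN, ReM, ImM, ReJ, ImJ).

Lemma complexP a b : Re a = Re b -> Im a = Im b -> a = b.
Proof. by case: a b => ? ? [? ?] /= -> ->. Qed.

Lemma conjcM a b : conjc (a * b) = conjc a * conjc b. Proof. exact: rmorphM. Qed.
Lemma conjcD a b : conjc (a + b) = conjc a + conjc b. Proof. exact: rmorphD. Qed.
Lemma conjcN a : conjc (- a) = - conjc a. Proof. exact: rmorphN. Qed.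

Lemma normc_sqr a : normc a ^+ 2 = Re a ^+ 2 + Im a ^+ 2.
Proof. by case: a => x y /=; rewrite sqr_sqrtr// addr_ge0 ?sqr_ge0. Qed.

Lemma normc_ge0 a : 0 <= normc a. Proof. by case: a => x y; exact: sqrtr_ge0. Qed.

Lemma normRe_le a : `|Re a| <= normc a.
Proof.
rewrite -(@ler_pXn2r _ 2)// ?nnegrE ?normc_ge0// real_normK ?num_real//.
by rewrite normc_sqr lerDl sqr_ge0.
Qed.

Lemma normIm_le a : `|Im a| <= normc a.
Proof.
rewrite -(@ler_pXn2r _ 2)// ?nnegrE ?normc_ge0// real_normK ?num_real//.
by rewrite normc_sqr lerDr sqr_ge0.
Qed.

Lemma normc_le_ReIm a : normc a <= `|Re a| + `|Im a|.
Proof.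
rewrite -(@ler_pXn2r _ 2)// ?nnegrE ?normc_ge0 ?addr_ge0// normc_sqr.
have := normr_ge0 (Re a); have := normr_ge0 (Im a).
rewrite -(real_normK (num_real (Re a))) -(real_normK (num_real (Im a))); nra.
Qed.

Lemma L2P f : L2 f <-> L2r (Re \o f) /\ L2r (Im \o f).
Proof.
split.
- move=> [[mr mi] foo].
  have fi : intg (fun x => normc (f x) ^+ 2).
    apply/integrableP; split.
      apply/measurable_EFinP; apply: (@eq_measurable_fun _ _ _ _ _
        (fun x => Re (f x) ^+ 2 + Im (f x) ^+ 2)).
        by move=> x _; rewrite normc_sqr.
      by apply: measurable_funD; exact: measurable_funX.
    rewrite (_ : (\int[mu]_(x in D) _ = \int[mu]_(x in D) ((normc (f x)) ^+ 2)%:E)%E)//.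
    by apply: eq_integral => x _; rewrite /= ger0_norm// sqr_ge0.
  split; split => //.
  + apply: le_integrable02pi fi; first exact: measurable_funX.
    by move=> x _; rewrite /= normc_sqr ger0_norm ?sqr_ge0// lerDl sqr_ge0.
  + apply: le_integrable02pi fi; first exact: measurable_funX.
    by move=> x _; rewrite /= normc_sqr ger0_norm ?sqr_ge0// lerDr sqr_ge0.
- move=> [[mr ri] [mi ii]]; split; first by split.
  have := integrable_lty (@measurable_interval02pi R) (intgD ri ii).
  rewrite (_ : (\int[mu]_(x in D) _ = \int[mu]_(x in D) ((normc (f x)) ^+ 2)%:E)%E)//.
  by apply: eq_integral => x _; rewrite /= normc_sqr.
Qed.

Lemma L2D f g : L2 f -> L2 g -> L2 (fun x => f x + g x).
Proof.
move=> /L2P[fr fi] /L2P[gr gi]; apply/L2P; split.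
- by rewrite (_ : _ \o _ = fun x => Re (f x) + Re (g x)); [exact: L2rD|apply/funext => x; exact: ReD].
- by rewrite (_ : _ \o _ = fun x => Im (f x) + Im (g x)); [exact: L2rD|apply/funext => x; exact: ImD].
Qed.

Lemma L2Z a f : L2 f -> L2 (fun x => a * f x).
Proof.
move=> /L2P[fr fi]; apply/L2P; split.
- rewrite (_ : _ \o _ = fun x => Re a * Re (f x) - Im a * Im (f x)).
    by apply: L2rB; exact: L2rZ.
  by apply/funext => x; exact: ReM.
- rewrite (_ : _ \o _ = fun x => Re a * Im (f x) + Im a * Re (f x)).
    by apply: L2rD; exact: L2rZ.
  by apply/funext => x; exact: ImM.
Qed.

Lemma L2N f : L2 f -> L2 (fun x => - f x).
Proof. by move=> /(L2Z (-1)); under eq_fun do rewrite mulN1r. Qed.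

Lemma L2B f g : L2 f -> L2 g -> L2 (fun x => f x - g x).
Proof. by move=> f2 /L2N; exact: L2D. Qed.

Lemma L2_cst a : L2 (fun=> a).
Proof. by apply/L2P; split; exact: L2r_cst. Qed.

Lemma L2J f : L2 f -> L2 (fun x => conjc (f x)).
Proof.
move=> /L2P[fr fi]; apply/L2P; split.
- by rewrite (_ : _ \o _ = Re \o f)//; apply/funext => x; exact: ReJ.
- by rewrite (_ : _ \o _ = fun x => - Im (f x)); [exact: L2rN|apply/funext => x; exact: ImJ].
Qed.

Lemma Linfty_L2 f : Linfty f -> L2 f.
Proof.
move=> [[mr mi] [M fM]]; split => //.
have m2 : @measurable_fun _ _ (measurableTypeR R) _ D (fun x => (normc (f x) ^+ 2)%:E).
  apply/measurable_EFinP; apply: (@eq_measurable_fun _ _ _ _ _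
        (fun x => Re (f x) ^+ 2 + Im (f x) ^+ 2)).
    by move=> x _; rewrite normc_sqr.
  by apply: measurable_funD; exact: measurable_funX.
apply: (@le_lt_trans _ _ (\int[mu]_(x in D) (cst (M ^+ 2)%:E x))%E).
  apply: ae_ge0_le_integral => //.
  - exact: measurable_interval02pi.
  - by move=> x _; rewrite lee_fin sqr_ge0.
  - by move=> x _; rewrite lee_fin sqr_ge0.
  - move: fM; apply: (@filterS _ _ (ae_filter_ringOfSetsType mu)) => x h /h xM; rewrite /cst lee_fin.
    by rewrite lerXn2r ?nnegrE ?normc_ge0// (le_trans (normc_ge0 (f x)) xM).
have := integrable_lty (@measurable_interval02pi R) (intg_cst (M ^+ 2)).
exact.
Qed.

(** * Calculus of complex-valued H^1 functions *)

Lemma H1P u du : H1_repr u du <-> ac (Re \o u) (Re \o du) /\ ac (Im \o u) (Im \o du).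
Proof.
split.
- move=> [/L2P[dr di] uE]; split; split => // x xc; rewrite /= uE ?in_itv//=.
    by rewrite ReD.
  by rewrite ImD.
- move=> [[dr ur] [di ui]]; split; first exact/L2P.
  by move=> x; rewrite in_itv /= => xc; apply: complexP; rewrite ?ReD ?ImD; [exact: ur|exact: ui].
Qed.

Lemma H1D u du v dv : H1_repr u du -> H1_repr v dv ->
  H1_repr (fun x => u x + v x) (fun x => du x + dv x).
Proof.
move=> /H1P[ur ui] /H1P[vr vi]; apply/H1P; split.
- have := acD ur vr; congr ac; apply/funext => x; rewrite /= ReD//.
- have := acD ui vi; congr ac; apply/funext => x; rewrite /= ImD//.
Qed.

Lemma H1M u du v dv : H1_repr u du -> H1_repr v dv ->
  H1_repr (fun x => u x * v x) (fun x => du x * v x + u x * dv x).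
Proof.
move=> /H1P[ur ui] /H1P[vr vi]; apply/H1P; split.
- have := acB (ac_mul ur vr) (ac_mul ui vi).
  by congr ac; apply/funext => x; rewrite /= !ReImE; ring.
- have := acD (ac_mul ur vi) (ac_mul ui vr).
  by congr ac; apply/funext => x; rewrite /= !ReImE; ring.
Qed.

Lemma H1_cst a : H1_repr (fun=> a) (fun=> 0).
Proof. by apply/H1P; split; exact: ac_cst. Qed.

Lemma H1Z a u du : H1_repr u du -> H1_repr (fun x => a * u x) (fun x => a * du x).
Proof.
move=> /(H1M (H1_cst a)); congr H1_repr; apply/funext => x.
by rewrite mul0r add0r.
Qed.

Lemma H1N u du : H1_repr u du -> H1_repr (fun x => - u x) (fun x => - du x).
Proof. by move=> /(H1Z (-1)); congr H1_repr; apply/funext => x; rewrite mulN1r. Qed.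

Lemma H1B u du v dv : H1_repr u du -> H1_repr v dv ->
  H1_repr (fun x => u x - v x) (fun x => du x - dv x).
Proof. by move=> hu /H1N; exact: H1D. Qed.

Lemma H1J u du : H1_repr u du -> H1_repr (fun x => conjc (u x)) (fun x => conjc (du x)).
Proof.
move=> /H1P[ur ui]; apply/H1P; split.
- by move: ur; congr ac; apply/funext => x; rewrite /= ReJ.
- by have := acN ui; congr ac; apply/funext => x; rewrite /= ImJ.
Qed.

Lemma H1_int f : L2 f -> H1_repr (fun x => integralC `]0, x[%classic f) f.
Proof. by move=> /L2P[fr fi]; apply/H1P; split; exact: ac_Iv. Qed.

Lemma integralC0 f : integralC `]0, 0[%classic f = 0.
Proof. by apply: complexP; exact: Iv_xx. Qed.

Lemma H1_L2 u du : H1_repr u du -> L2 u.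
Proof. by move=> /H1P[ur ui]; apply/L2P; split; [exact: ac_L2 ur|exact: ac_L2 ui]. Qed.

Lemma L2_mulH1 u du f : H1_repr u du -> L2 f -> L2 (fun x => f x * u x).
Proof.
move=> /H1P[ur ui] /L2P[fr fi]; apply/L2P; split.
- have := L2rB (L2r_mul_ac ur fr) (L2r_mul_ac ui fi).
  by congr L2r; apply/funext => x; rewrite /= ReM.
- have := L2rD (L2r_mul_ac ui fr) (L2r_mul_ac ur fi).
  by congr L2r; apply/funext => x; rewrite /= ImM.
Qed.

Lemma H1_bounded u du : H1_repr u du ->
  exists M, forall x, 0 <= x <= c -> normc (u x) <= M.
Proof.
move=> /H1P[/ac_bounded[M1 h1] /ac_bounded[M2 h2]]; exists (M1 + M2) => x xc.
by rewrite (le_trans (normc_le_ReIm _))// lerD; [|exact: h1|exact: h2].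
Qed.

(** This allows end values and derivatives to be read off a pair of a graph, and makes [A_op]
    single-valued. *)
Lemma H1_uniq u du v dv : H1_repr u du -> H1_repr v dv -> eqae u v ->
  (forall x, 0 <= x <= c -> u x = v x) /\ eqae du dv.
Proof.
move=> hu hv uv.
have /H1P[wr wi] := H1B hu hv.
have wr0 : forall x, 0 <= x <= c -> Re (u x - v x) = 0.
  apply: (ac_eq0 wr); move: uv; apply: filterS => x h /h /= ->.
  by rewrite subrr.
have wi0 : forall x, 0 <= x <= c -> Im (u x - v x) = 0.
  apply: (ac_eq0 wi); move: uv; apply: filterS => x h /h /= ->.
  by rewrite subrr.
split.
  move=> x xc; apply/eqP; rewrite -subr_eq0; apply/eqP.
  by apply: complexP; [exact: wr0|exact: wi0].
have := ac_deriv0 wr wr0; have := ac_deriv0 wi wi0.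
rewrite /eqae; apply: filterS2 => x h1 h2 Dx; apply/eqP; rewrite -subr_eq0; apply/eqP.
by apply: complexP; [exact: h2|exact: h1].
Qed.

(** The exponential in Euler's form, so that the real rules for [expR], [cos] and [sin]
    differentiate its components. *)
Definition cexp z : R[i] := Complex (expR (Re z) * cos (Im z)) (expR (Re z) * sin (Im z)).

Lemma cexp0 : cexp 0 = 1.
Proof. by rewrite /cexp /= expR0 cos0 sin0 mulr1 mulr0. Qed.

Lemma cexpNK z : cexp (- z) * cexp z = 1.
Proof.
rewrite /cexp ReN ImN sinN cosN.
have e : expR (- Re z) * expR (Re z) = 1 by rewrite -expRD addNr expR0.
have sc := cos2Dsin2 (Im z).
apply: complexP; rewrite ?ReM ?ImM /=; last by ring.
transitivity ((expR (- Re z) * expR (Re z)) * (cos (Im z) ^+ 2 + sin (Im z) ^+ 2)).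
  by ring.
by rewrite e sc mulr1.
Qed.

Lemma H1_cexp P p : H1_repr P p ->
  H1_repr (fun x => cexp (P x)) (fun x => p x * cexp (P x)).
Proof.
move=> /H1P[Pr Pi]; apply/H1P; split.
- have := ac_mul (ac_exp Pr) (ac_cos Pi).
  by congr ac; apply/funext => x; rewrite /= ReM /=; ring.
- have := ac_mul (ac_exp Pr) (ac_sin Pi).
  by congr ac; apply/funext => x; rewrite /= ImM /=; ring.
Qed.

(** * Complex integrals and the L^2 norm *)

Definition integrableC f := intg (Re \o f) /\ intg (Im \o f).

Lemma L2_integrableM f g : L2 f -> L2 g -> integrableC (fun x => f x * g x).
Proof.
move=> /L2P[fr fi] /L2P[gr gi]; split.
- by apply: (eq_integrable02pi _ (intgB (L2r_mul fr gr) (L2r_mul fi gi))) => x; rewrite /= ReM.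
- by apply: (eq_integrable02pi _ (intgD (L2r_mul fr gi) (L2r_mul fi gr))) => x; rewrite /= ImM.
Qed.

Lemma L2_integrableC f : L2 f -> integrableC f.
Proof. by move=> /L2P[fr fi]; split; exact: L2r_intg. Qed.

Local Notation cI f := (integralC D f).

Lemma integralCD f g : integrableC f -> integrableC g -> cI (fun x => f x + g x) = cI f + cI g.
Proof.
move=> [fr fi] [gr gi]; apply: complexP.
- rewrite ReD /= -(RintegralD (@measurable_interval02pi R) fr gr).
  by apply: eq_Rintegral => x _; rewrite ReD.
- rewrite ImD /= -(RintegralD (@measurable_interval02pi R) fi gi).
  by apply: eq_Rintegral => x _; rewrite ImD.
Qed.

Lemma integralCZ a f : integrableC f -> cI (fun x => a * f x) = a * cI f.
Proof.
move=> [fr fi]; apply: complexP.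
- rewrite ReM /= -(RintegralZl _ (@measurable_interval02pi R) fr) -(RintegralZl _ (@measurable_interval02pi R) fi).
  rewrite -(RintegralB (@measurable_interval02pi R) (intgZ _ fr) (intgZ _ fi)).
  by apply: eq_Rintegral => x _; rewrite ReM.
- rewrite ImM /= -(RintegralZl _ (@measurable_interval02pi R) fr) -(RintegralZl _ (@measurable_interval02pi R) fi).
  rewrite -(RintegralD (@measurable_interval02pi R) (intgZ _ fi) (intgZ _ fr)).
  by apply: eq_Rintegral => x _; rewrite ImM.
Qed.

Lemma integrableCD f g : integrableC f -> integrableC g -> integrableC (fun x => f x + g x).
Proof.
move=> [fr fi] [gr gi]; split.
- by apply: (eq_integrable02pi _ (intgD fr gr)) => x; rewrite /= ReD.
- by apply: (eq_integrable02pi _ (intgD fi gi)) => x; rewrite /= ImD.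
Qed.

Lemma integrableCZ a f : integrableC f -> integrableC (fun x => a * f x).
Proof.
move=> [fr fi]; split.
- by apply: (eq_integrable02pi _ (intgB (intgZ (Re a) fr) (intgZ (Im a) fi))) => x; rewrite /= ReM.
- by apply: (eq_integrable02pi _ (intgD (intgZ (Re a) fi) (intgZ (Im a) fr))) => x; rewrite /= ImM.
Qed.

Lemma eq_integralC_ae f g : integrableC f -> integrableC g -> eqae f g -> cI f = cI g.
Proof.
move=> [fr fi] [gr gi] fg; apply: complexP; rewrite /= -!IvE.
- apply: eq_Iv_ae => //; [exact: intg_meas|exact: intg_meas| ].
  by move: fg; apply: filterS => x h /h /= ->.
- apply: eq_Iv_ae => //; [exact: intg_meas|exact: intg_meas| ].
  by move: fg; apply: filterS => x h /h /= ->.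
Qed.

Lemma L2norm_sqr f : L2norm f ^+ 2 =
  \int[mu]_(x in D) (Re (f x) ^+ 2 + Im (f x) ^+ 2).
Proof.
rewrite /L2norm sqr_sqrtr; last by apply: Rintegral_ge0 => x _; exact: sqr_ge0.
by apply: eq_Rintegral => x _; rewrite normc_sqr.
Qed.

Lemma L2norm_ge0 f : 0 <= L2norm f. Proof. exact: sqrtr_ge0. Qed.

Lemma eq_L2norm_ae f g : L2 f -> L2 g -> eqae f g -> L2norm f = L2norm g.
Proof.
move=> /L2P[fr fi] /L2P[gr gi] fg; apply/eqP.
rewrite -(@eqrXn2 _ 2)// ?L2norm_ge0// !L2norm_sqr -!IvE; apply/eqP.
apply: eq_Iv_ae; [| | |exact: lexx|exact: lexx].
- by apply: measurable_funD; apply: measurable_funX; [exact: fr.1|exact: fi.1].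
- by apply: measurable_funD; apply: measurable_funX; [exact: gr.1|exact: gi.1].
- by move: fg; apply: filterS => x h /h ->.
Qed.

Lemma L2norm_eq0 f : L2 f -> \int[mu]_(x in D) (Re (f x) ^+ 2 + Im (f x) ^+ 2) <= 0 ->
  eqae f (fun=> 0).
Proof.
move=> /L2P[fr fi]; rewrite (RintegralD (@measurable_interval02pi R) fr.2 fi.2) => h.
have r0 : 0 <= \int[mu]_(x in D) (Re (f x) ^+ 2).
  by apply: Rintegral_ge0 => x _; exact: sqr_ge0.
have i0 : 0 <= \int[mu]_(x in D) (Im (f x) ^+ 2).
  by apply: Rintegral_ge0 => x _; exact: sqr_ge0.
have hr : \int[mu]_(x in D) (Re (f x) ^+ 2) = 0 by lra.
have hi : \int[mu]_(x in D) (Im (f x) ^+ 2) = 0 by lra.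
have := int_sqr_eq0 fr hr; have := int_sqr_eq0 fi hi.
rewrite /eqae; apply: filterS2 => x h1 h2 Dx.
by apply: complexP; [exact: h2|exact: h1].
Qed.

Lemma H1_dense h (e : R) : L2 h -> 0 < e ->
  exists u du, [/\ H1_repr u du, u 0 = 0, u c = 0 & L2norm (fun x => h x - u x) < e].
Proof.
move=> /L2P[hr hi] e0.
have e1 : 0 < e ^+ 2 / 2 by rewrite divr_gt0// exprn_gt0.
have [F [f [acF F0 Fc Fe]]] := approx_L2 hr e1.
have [G [g [acG G0 Gc Ge]]] := approx_L2 hi e1.
exists (fun x => Complex (F x) (G x)), (fun x => Complex (f x) (g x)); split.
- by apply/H1P; split.
- by rewrite F0 G0.
- by rewrite Fc Gc.
rewrite -(@ltr_pXn2r _ 2)// ?nnegrE ?L2norm_ge0 ?ltW// L2norm_sqr.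
have i1 := (L2rB hr (ac_L2 acF)).2; have i2 := (L2rB hi (ac_L2 acG)).2.
rewrite (_ : \int[mu]_(x in D) _ = \int[mu]_(x in D) ((Re (h x) - F x) ^+ 2 + (Im (h x) - G x) ^+ 2)).
  rewrite (RintegralD (@measurable_interval02pi R) i1 i2).
  by rewrite [ltRHS]splitr ltrD.
by apply: eq_Rintegral => x _; rewrite !ReImE.
Qed.

Lemma Iv_norm_L2norm (h : R -> R[i]) x : L2 h -> 0 <= x <= c ->
  Iv 0 x (fun t => `|Re (h t)| + `|Im (h t)|) <= 2 * (Num.sqrt c * L2norm h).
Proof.
move=> /L2P[hr hi] /andP[x0 xc].
have ri := intg_norm (L2r_intg hr); have ii := intg_norm (L2r_intg hi).
rewrite (IvD ri ii)// mulr_natl mulr2n.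
have aux (q : R -> R) : L2r q -> (forall t, q t ^+ 2 <= Re (h t) ^+ 2 + Im (h t) ^+ 2) ->
    Iv 0 x (fun t => `|q t|) <= Num.sqrt c * L2norm h.
  move=> q2 qh; rewrite -(@ler_pXn2r _ 2)// ?nnegrE; last 2 first.
  - by apply: Iv_ge0.
  - by rewrite mulr_ge0 ?sqrtr_ge0.
  rewrite exprMn (sqr_sqrtr (two_pi_ge0 R)) L2norm_sqr.
  rewrite (le_trans (Iv_norm_sqr q2 (lexx _) x0 xc))// subr0.
  apply: (@le_trans _ _ (c * Iv 0 x (fun t => q t ^+ 2))).
    by apply: ler_wpM2r => //; apply: Iv_ge0 => t _; exact: sqr_ge0.
  rewrite ler_wpM2l ?two_pi_ge0// -IvE.
  have i2 := intgD hr.2 hi.2.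
  rewrite (Iv_cat i2 (lexx _) x0 xc (lexx _)).
  rewrite -[leLHS]addr0 lerD//.
    by apply: le_Iv => //; exact: q2.2.
  by apply: Iv_ge0 => t _; rewrite addr_ge0 ?sqr_ge0.
apply: lerD; apply: aux => // t; first by rewrite lerDl sqr_ge0.
by rewrite lerDr sqr_ge0.
Qed.

Lemma normc_int_mul v dv h (M : R) : H1_repr v dv -> L2 h ->
  (forall x, 0 <= x <= c -> normc (v x) <= M) ->
  forall x, 0 <= x <= c ->
  normc (integralC `]0, x[%classic (fun t => h t * v t)) <= 4 * M * (Num.sqrt c * L2norm h).
Proof.
move=> hv h2 vM x xc; have /andP[x0 xc'] := xc.
have /L2P[hr hi] := h2.
have M0 : 0 <= M by apply: le_trans (normc_ge0 (v x)) (vM x xc).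
have /L2P[pr pi'] := L2_mulH1 hv h2.
have ri := intg_norm (L2r_intg hr); have ii := intg_norm (L2r_intg hi).
have pt t : 0 < t < x -> normc (h t * v t) <= M * (`|Re (h t)| + `|Im (h t)|).
  move=> /andP[/ltW t0 /ltW tx].
  rewrite ComplexField.Normc.normcM mulrC ler_pM ?normc_ge0 ?normc_le_ReIm//.
  by rewrite vM// t0 (le_trans tx).
have aux (q : R -> R) : intg q -> (forall t, `|q t| <= normc (h t * v t)) ->
    `|Iv 0 x q| <= M * (2 * (Num.sqrt c * L2norm h)).
  move=> qi qn; rewrite (le_trans (norm_Iv qi (lexx _) xc'))//.
  apply: (@le_trans _ _ (M * Iv 0 x (fun t => `|Re (h t)| + `|Im (h t)|))).
    rewrite -IvZ//; last exact: intgD.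
    apply: le_Iv => //; [exact: intg_norm|by apply: intgZ; exact: intgD|].
    by move=> t /pt; apply: le_trans; exact: qn.
  by rewrite ler_wpM2l// Iv_norm_L2norm.
rewrite (le_trans (normc_le_ReIm _))//.
(* One factor 2 comes from the components of [h], the other from those of the integral. *)
rewrite (_ : 4 * M * _ = M * (2 * (Num.sqrt c * L2norm h)) + M * (2 * (Num.sqrt c * L2norm h)));
  last by ring.
apply: lerD.
  by apply: (aux _ (L2r_intg pr)) => t; exact: normRe_le.
by apply: (aux _ (L2r_intg pi')) => t; exact: normIm_le.
Qed.

Lemma L2norm_bound f (M : R) : L2 f -> (forall x, 0 <= x <= c -> normc (f x) <= M) ->
  L2norm f <= Num.sqrt c * M.
Proof.
move=> /L2P[fr fi] fM.
have M0 : 0 <= M by apply: le_trans (normc_ge0 (f 0)) (fM 0 _); rewrite lexx two_pi_ge0.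
rewrite -(@ler_pXn2r _ 2)// ?nnegrE ?L2norm_ge0 ?mulr_ge0 ?sqrtr_ge0//.
rewrite exprMn (sqr_sqrtr (two_pi_ge0 R)) L2norm_sqr -IvE.
have := Iv_cst (M ^+ 2) (two_pi_ge0 R); rewrite subr0 (mulrC (M ^+ 2)) => <-.
apply: le_Iv => //; [by apply: intgD; [exact: fr.2|exact: fi.2]|exact: intg_cst|].
move=> t /andP[/ltW t0 /ltW tc]; rewrite -normc_sqr lerXn2r ?nnegrE ?normc_ge0//.
by rewrite fM// t0.
Qed.

End ComplexL2.

(** * The differential equation and the resolvent *)

Section Operators.
Variable R : realType.
Local Notation Re := (@complex.Re R).
Local Notation Im := (@complex.Im R).
Local Notation normc := ComplexField.Normc.normc.
Local Notation D := (interval02pi R).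
Local Notation mu := (@lebesgue_measure R).
Local Notation c := (2 * pi : R).
Local Notation cI f := (integralC D f).
Local Notation i := ('i%C : R[i]).
Implicit Types (f g h u v du dv k V : R -> R[i]) (x y : R) (a b z w rho : R[i]).

Lemma mulii : i * i = -1. Proof. by rewrite -expr2 sqr_i. Qed.

Lemma eqae_trans f g h : eqae f g -> eqae g h -> eqae f h.
Proof. by rewrite /eqae; apply: filterS2 => x h1 h2 Dx; rewrite h1// h2. Qed.

Lemma eqae_sym f g : eqae f g -> eqae g f.
Proof. by rewrite /eqae; apply: filterS => x h1 Dx; rewrite h1. Qed.

Lemma eqaeW f g : f =1 g -> eqae f g.
Proof. by move=> fg; apply: aeW => x _. Qed.

Lemma eqae_refl f : eqae f f. Proof. exact: eqaeW. Qed.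

Lemma eqae_comp2 (op : R -> R[i] -> R[i] -> R[i]) f g f' g' :
  eqae f f' -> eqae g g' -> eqae (fun x => op x (f x) (g x)) (fun x => op x (f' x) (g' x)).
Proof. by rewrite /eqae; apply: filterS2 => x h1 h2 Dx /=; rewrite h1// h2. Qed.

Lemma H1_const u du : H1_repr u du -> eqae du (fun=> 0) ->
  forall x, 0 <= x <= c -> u x = u 0.
Proof.
move=> hu du0 x xc; have /andP[x0 xc'] := xc.
have /H1P[[mr _] [mi _]] := hu.
have -> : u x = u 0 + integralC `]0, x[%classic du by apply: hu.2; rewrite in_itv.
rewrite -[RHS]addr0; congr (_ + _); apply: complexP.
- have := @eq_Iv_ae R (Re \o du) (fun=> 0) 0 x mr.1 (measurable_cst _) _ (lexx _) xc'.
  rewrite Iv_cst// mul0r; apply.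
  by move: du0; apply: filterS => t h /h /= ->.
- have := @eq_Iv_ae R (Im \o du) (fun=> 0) 0 x mi.1 (measurable_cst _) _ (lexx _) xc'.
  rewrite Iv_cst// mul0r; apply.
  by move: du0; apply: filterS => t h /h /= ->.
Qed.

(** * The fundamental solution of [i u' + V u = z u] *)

Section Fundamental.
Variables (V : R -> R[i]) (z : R[i]).
Hypothesis V2 : L2 V.

Let p x := i * (V x - z).
Let P x := integralC `]0, x[%classic p.

Let H1_P : H1_repr P p.
Proof. by apply: H1_int; apply: L2Z; apply: L2B => //; exact: L2_cst. Qed.

Definition fund x := cexp (P x).
(** The reciprocal of [fund], written as an exponential so that no quotient rule is needed. *)
Definition fundV x := cexp (- P x).

Lemma H1_fund : H1_repr fund (fun x => i * (V x - z) * fund x).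
Proof. exact: H1_cexp H1_P. Qed.

Lemma H1_fundV : H1_repr fundV (fun x => - (i * (V x - z)) * fundV x).
Proof. exact: H1_cexp (H1N H1_P). Qed.

Lemma fundVK x : fundV x * fund x = 1. Proof. exact: cexpNK. Qed.

Lemma fund0 : fund 0 = 1. Proof. by rewrite /fund /P integralC0 cexp0. Qed.

Lemma fundV0 : fundV 0 = 1.
Proof. by rewrite /fundV /P integralC0 oppr0 cexp0. Qed.

(** Variation of constants. The formula for [u] belongs to the conclusion because the resolvent
    estimate is read off it. *)
Lemma solve_ode h a : L2 h ->
  exists u du, [/\ H1_repr u du, u 0 = a,
    forall x, i * du x + V x * u x = z * u x + h x &
    forall x, u x = fund x * (a + integralC `]0, x[%classic (fun t => (- i * h t) * fundV t))].
Proof.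
move=> h2; have ih2 : L2 (fun t => - i * h t) by exact: L2Z.
have hJ := H1_int (L2_mulH1 H1_fundV ih2).
have hu := H1M H1_fund (H1D (H1_cst a) hJ).
eexists; eexists; split; first exact: hu.
- by rewrite /= integralC0 addr0 fund0 mul1r.
- move=> x /=; set E := fund x; set J := integralC _ _.
  have EK := fundVK x; rewrite -/E in EK.
  transitivity ((i * i) * (V x - z) * E * (a + J) + V x * (E * (a + J)) -
     (i * i) * h x * (fundV x * E)); first by ring.
  by rewrite EK mulii; ring.
- by [].
Qed.

(** The product [fundV * u] has derivative zero almost everywhere, so it keeps its value [u 0]. *)
Lemma ode_unique u du : H1_repr u du ->
  eqae (fun x => i * du x + V x * u x) (fun x => z * u x) ->
  forall x, 0 <= x <= c -> u x = fund x * u 0.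
Proof.
move=> hu ode x xc.
have hw := H1M H1_fundV hu.
have hw0 : eqae (fun x => - (i * (V x - z)) * fundV x * u x + fundV x * du x) (fun=> 0).
  move: ode; apply: filterS => t h /h /= e.
  transitivity (fundV t * - i * ((i * du t + V t * u t) - z * u t) +
     fundV t * (1 + i * i) * du t); first by ring.
  by rewrite e mulii; ring.
have := H1_const hw hw0 xc; rewrite /= fundV0 mul1r => <-.
by rewrite mulrA (mulrC (fund x)) fundVK mul1r.
Qed.

End Fundamental.

Lemma A_op_mem V rho k u du : L2 V -> L2 k -> H1_repr u du -> u 0 = rho * u c ->
  A_op V rho k (u, fun x => i * du x + V x * u x + u c * k x).
Proof.
move=> V2 k2 hu u0; split => /=.
- exact: H1_L2 hu.
- by apply: L2D; [apply: L2D; [exact: L2Z hu.1|exact: L2_mulH1 hu V2]|exact: L2Z].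
- by exists u, du; split => //; exact: eqae_refl.
Qed.

Lemma A_op_operator V rho k : is_operator (A_op V rho k).
Proof.
split.
- by move=> f g [].
- move=> f g f' g' [/= f2 g2 [u [du [hu fu u0 gu]]]] f'2 g'2 ff' gg'.
  split => //=; exists u, du; split => //.
  + exact: eqae_trans (eqae_sym ff') fu.
  + exact: eqae_trans (eqae_sym gg') gu.
- move=> f g g' [/= f2 g2 [u [du [hu fu u0 gu]]]] [/= _ g'2 [v [dv [hv fv v0 gv]]]].
  have [uv duv] := H1_uniq hu hv (eqae_trans (eqae_sym fu) fv).
  apply: (eqae_trans gu); apply: eqae_sym; apply: (eqae_trans gv); apply: eqae_sym.
  move: duv; apply: filterS => x h Dx; rewrite h// !uv//; first by rewrite two_pi_ge0 lexx.
  exact: interval02pi_le.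
- split => /=; [exact: L2_cst|exact: L2_cst|].
  exists (fun=> 0), (fun=> 0); split => //; first exact: H1_cst.
  + exact: eqae_refl.
  + by rewrite mulr0.
  + by apply: aeW => x _; rewrite !mulr0 mul0r !addr0.
- move=> a f g f' g' [/= f2 g2 [u [du [hu fu u0 gu]]]] [/= f'2 g'2 [v [dv [hv fv v0 gv]]]].
  split => /=; [by apply: L2D => //; exact: L2Z|by apply: L2D => //; exact: L2Z|].
  exists (fun x => a * u x + v x), (fun x => a * du x + dv x); split.
  + exact: H1D (H1Z a hu) hv.
  + exact: (eqae_comp2 (fun _ s t => a * s + t)).
  + by rewrite u0 v0; ring.
  + apply: (eqae_trans (eqae_comp2 (fun _ s t => a * s + t) gu gv)).
    by apply: aeW => x _; ring.
Qed.

Lemma A_min_sub V rho k : A_min V `<=` A_op V rho k.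
Proof.
move=> [f g] [/= f2 g2 [u [du [hu fu u0 uc gu]]]]; split => //=.
exists u, du; split => //; first by rewrite u0 uc mulr0.
by rewrite uc; apply: (eqae_trans gu); apply: aeW => x _; rewrite mul0r addr0.
Qed.

Lemma A_op_dense V rho k : L2 V -> L2 k -> densely_defined (A_op V rho k).
Proof.
move=> V2 k2 h h2 e e0; have [u [du [hu u0 uc ue]]] := H1_dense h2 e0.
exists u; split => //; eexists.
by apply: (A_op_mem V2 k2 hu); rewrite u0 uc mulr0.
Qed.

(* [u1] solves the equation with source [h] and [u1 0 = 0], [u2] the one with
   source [- k] and [u2 0 = rho]; then [u1 + w u2] lies in the domain with value
   [w] at [2 pi] iff [w (1 - u2 (2 pi)) = u1 (2 pi)]. *)
Lemma resolvent_or_eigenfunction V rho k z : L2 V -> L2 k ->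
  resolvent_set (A_op V rho k) z \/
  exists u du, [/\ H1_repr u du, u 0 = rho, u c = 1 &
    forall x, i * du x + V x * u x + k x = z * u x].
Proof.
move=> V2 k2.
have [u2 [du2 [hu2 u20 ode2 _]]] := solve_ode z V2 rho (L2N k2).
have [u2c|u2c] := eqVneq (u2 c) 1.
  right; exists u2, du2; split => // x.
  by rewrite ode2 subrK.
left.
have d0 : 1 - u2 c != 0 by rewrite subr_eq0 eq_sym.
have [M2 hM2] := H1_bounded hu2.
have [ME hME] := H1_bounded (H1_fund z V2).
have [MV hMV] := H1_bounded (H1_fundV z V2).
have c0c : 0 <= (0 : R) <= c by rewrite lexx two_pi_ge0.
have ccc : 0 <= c <= c by rewrite lexx two_pi_ge0.
have pos u du M : H1_repr u du -> (forall x, 0 <= x <= c -> normc (u x) <= M) -> 0 <= M.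
  by move=> _ /(_ 0 c0c); apply: le_trans; exact: normc_ge0.
have M20 := pos _ _ _ hu2 hM2.
have ME0 := pos _ _ _ (H1_fund z V2) hME.
have MV0 := pos _ _ _ (H1_fundV z V2) hMV.
pose K1 := ME * (4 * MV * Num.sqrt c).
have K10 : 0 <= K1 by rewrite !mulr_ge0// sqrtr_ge0.
have bound1 h u : L2 h -> (forall x, u x = fund V z x *
     (0 + integralC `]0, x[%classic (fun t => (- i * h t) * fundV V z t))) ->
   forall x, 0 <= x <= c -> normc (u x) <= K1 * L2norm h.
  move=> h2 uE x xc; rewrite uE add0r ComplexField.Normc.normcM.
  have ih2 : L2 (fun t => - i * h t) by exact: L2Z.
  have := normc_int_mul (H1_fundV z V2) ih2 hMV xc.
  have -> : L2norm (fun t => - i * h t) = L2norm h.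
    rewrite /L2norm; congr Num.sqrt; apply: eq_Rintegral => t _.
    by rewrite !normc_sqr !ReImE /=; ring.
  move=> hJ; rewrite /K1 -!mulrA; apply: ler_pM => //; rewrite ?normc_ge0 ?hME//.
  by rewrite !mulrA -(mulrA _ (Num.sqrt c)).
(* Up to the factor [L2norm h], [K1] bounds [u1] and [K1 / normc (1 - u2 c)] bounds
   [u c = u1 c / (1 - u2 c)], while [M2] bounds [u2]; [Num.sqrt c] passes from the supremum to the
   L^2 norm. *)
pose C := Num.sqrt c * (K1 + K1 / normc (1 - u2 c) * M2).
have nd0 : 0 < normc (1 - u2 c).
  rewrite lt_neqAle normc_ge0 andbT eq_sym; apply: contra d0 => /eqP.
  by move=> /ComplexField.Normc.eq0_normc ->.
(* This one estimate serves twice: as the bound on the inverse, and for injectivity when the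
   right-hand side vanishes. *)
have bnd f g : A_op V rho k (f, g) -> L2norm f <= C * L2norm (fun x => g x - z * f x).
  move=> [/= f2 g2 [u [du [hu fu u0 gu]]]].
  have h2 : L2 (fun x => g x - z * f x) by apply: L2B => //; exact: L2Z.
  have [u1 [du1 [hu1 u10 ode1 u1E]]] := solve_ode z V2 0 h2.
  have hv := H1B hu (H1D hu1 (H1Z (u c) hu2)).
  have odev : eqae (fun x => i * (du x - (du1 x + u c * du2 x)) +
      V x * (u x - (u1 x + u c * u2 x)))
      (fun x => z * (u x - (u1 x + u c * u2 x))).
    move: fu gu; rewrite /eqae; apply: filterS2 => x e1 e2 Dx.
    have {}e1 := e1 Dx; have {}e2 := e2 Dx.
    transitivity ((i * du x + V x * u x + u c * k x) - (i * du1 x + V x * u1 x)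
       - u c * ((i * du2 x + V x * u2 x) + k x)); first by ring.
    by rewrite -e2 ode1 ode2 e1; ring.
  have uE x : 0 <= x <= c -> u x = u1 x + u c * u2 x.
    move=> xc; apply/eqP; rewrite -subr_eq0; apply/eqP.
    by rewrite (ode_unique V2 hv odev xc) u10 u20 u0; ring.
  have ucE : u c = u1 c / (1 - u2 c).
    apply: (mulIf d0); rewrite divfK// mulrBr mulr1 [X in X - _](uE c ccc).
    by rewrite addrK.
  have n1 := bound1 _ _ h2 u1E.
  rewrite (eq_L2norm_ae f2 (H1_L2 hu) fu) /C -mulrA.
  apply: L2norm_bound; first exact: H1_L2 hu.
  move=> x xc; rewrite (uE x xc) (le_trans (le_normcD _ _))//.
  rewrite (mulrDl K1) lerD ?n1// ComplexField.Normc.normcM mulrAC.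
  apply: ler_pM; rewrite ?normc_ge0 ?hM2// ucE.
  rewrite ComplexField.Normc.normcM ComplexField.Normc.normcV mulrAC.
  by rewrite ler_wpM2r ?n1// invr_ge0 normc_ge0.
split.
- move=> f g Tfg gz; have f2 := (operator_L2 (A_op_operator V rho k) Tfg).1.
  have g2 := (operator_L2 (A_op_operator V rho k) Tfg).2.
  have := bnd _ _ Tfg.
  rewrite (@eq_L2norm_ae _ (fun x => g x - z * f x) (fun=> 0)); last 3 first.
  + by apply: L2B => //; exact: L2Z.
  + exact: L2_cst.
  + by move: gz; apply: filterS => x h /h ->; rewrite subrr.
  have -> : L2norm (fun=> 0 : R[i]) = 0.
    apply/eqP; rewrite -sqrf_eq0 L2norm_sqr -IvE; apply/eqP.
    by rewrite (Iv_cst _ (two_pi_ge0 R)) expr0n addr0 mul0r.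
  rewrite mulr0 => f0; apply: L2norm_eq0 => //.
  have {}f0 : L2norm f = 0 by apply/eqP; rewrite eq_le f0 L2norm_ge0.
  by rewrite -L2norm_sqr f0 expr0n.
- move=> h h2; have [u1 [du1 [hu1 u10 ode1 u1E]]] := solve_ode z V2 0 h2.
  pose w := u1 c / (1 - u2 c).
  have hu := H1D hu1 (H1Z w hu2).
  have uc : u1 c + w * u2 c = w.
    apply: (mulIf d0); rewrite /w; field; exact: d0.
  have u0 : u1 0 + w * u2 0 = rho * (u1 c + w * u2 c).
    by rewrite uc u10 u20 add0r mulrC.
  eexists; eexists; split; first exact: (A_op_mem V2 k2 hu u0).
  apply: aeW => x _ /=; rewrite uc.
  transitivity ((i * du1 x + V x * u1 x) + w * ((i * du2 x + V x * u2 x) + k x)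
     - z * (u1 x + w * u2 x)); first by ring.
  by rewrite ode1 ode2; ring.
- by exists C.
Qed.

End Operators.

(** * Dissipativity *)

Section Dissipative.
Variable R : realType.
Local Notation Re := (@complex.Re R).
Local Notation Im := (@complex.Im R).
Local Notation normc := ComplexField.Normc.normc.
Local Notation D := (interval02pi R).
Local Notation mu := (@lebesgue_measure R).
Local Notation c := (2 * pi : R).
Local Notation cI f := (integralC D f).
Local Notation i := ('i%C : R[i]).
Local Notation intg f := (mu.-integrable D (EFin \o f)).
Implicit Types (f g h u v du dv k V : R -> R[i]) (x y : R) (a b z w rho : R[i]).

Lemma H1_neq0 u du : H1_repr u du -> u c = 1 -> ~ eqae u (fun=> 0).
Proof.
move=> hu uc u0; have [+ _] := H1_uniq hu (H1_cst 0) u0.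
move=> /(_ c); rewrite two_pi_ge0 lexx uc => /(_ isT) /eqP.
by rewrite oner_eq0.
Qed.

Lemma eigenfunction_graph V rho k z u du : L2 V -> L2 k ->
  H1_repr u du -> u 0 = rho -> u c = 1 ->
  eqae (fun x => i * du x + V x * u x + k x) (fun x => z * u x) ->
  A_op V rho k (u, fun x => z * u x).
Proof.
move=> V2 k2 hu u0 uc ode.
have e : u 0 = rho * u c by rewrite uc u0 mulr1.
have := A_op_mem V2 k2 hu e; rewrite uc => Tu.
have u2 := H1_L2 hu.
apply: (operator_eqae (A_op_operator V rho k) Tu u2 (L2Z z u2) (eqae_refl _)).
by apply: eqae_trans ode; apply: aeW => x _; rewrite mul1r.
Qed.

Lemma eigenfunction_spectrum V rho k z u du : L2 V -> L2 k ->
  H1_repr u du -> u 0 = rho -> u c = 1 ->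
  eqae (fun x => i * du x + V x * u x + k x) (fun x => z * u x) ->
  spectrum (A_op V rho k) z.
Proof.
move=> V2 k2 hu u0 uc ode [inj _ _].
apply: (H1_neq0 hu uc); apply: inj (eigenfunction_graph V2 k2 hu u0 uc ode) _.
exact: eqae_refl.
Qed.

Lemma inner_eqae f g f' g' : L2 f -> L2 g -> L2 f' -> L2 g' ->
  eqae f f' -> eqae g g' -> inner f g = inner f' g'.
Proof.
move=> f2 g2 f'2 g'2 ff' gg'; apply: eq_integralC_ae.
- by apply: L2_integrableM => //; exact: L2J.
- by apply: L2_integrableM => //; exact: L2J.
- exact: (eqae_comp2 (fun _ s t => conjc s * t)).
Qed.

Lemma Im_innerZ f a : L2 f ->
  Im (inner f (fun x => a * f x)) = Im a * \int[mu]_(x in D) (Re (f x) ^+ 2 + Im (f x) ^+ 2).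
Proof.
move=> /L2P[fr fi].
rewrite -(RintegralZl _ (@measurable_interval02pi R) (intgD fr.2 fi.2)).
by apply: eq_Rintegral => x _; rewrite /= !ReImE; ring.
Qed.

(** The remark that a dissipative operator has no eigenvector at [- i] is used twice: for the
    operator itself, to make [A + i] surjective, and for the extension [S], to make [S + i]
    injective. *)
Lemma dissipative_maximal V rho k : L2 V -> L2 k ->
  dissipative (A_op V rho k) -> maximally_dissipative (A_op V rho k).
Proof.
move=> V2 k2 dT; split => // S [opS _ dS] TS; have [opT _ dT'] := dT.
have [[_ surj _]|] := resolvent_or_eigenfunction rho (- i) V2 k2; last first.
  move=> [u [du [hu u0 uc ode]]].
  have Tu := @eigenfunction_graph _ _ _ (- i) _ _ V2 k2 hu u0 uc (eqaeW ode).
  have := dT' _ _ Tu; rewrite Im_innerZ; last exact: H1_L2 hu.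
  rewrite ImN mulN1r oppr_ge0 => /(L2norm_eq0 (H1_L2 hu)).
  by move=> /(H1_neq0 hu uc).
apply/seteqP; split => // -[f g] Sfg.
have [f2 g2] := operator_L2 opS Sfg.
have h2 : L2 (fun x => g x + i * f x) by apply: L2D => //; exact: L2Z.
(* [f'] has the same image under [A + i] as [f] under [S + i], so [S] maps [f - f'] to [- i] times
   itself. *)
have [f' [g' [Tfg' e]]] := surj _ h2.
have [f'2 g'2] := operator_L2 opS (TS _ Tfg').
have Sd := operator_linear opS (-1) (TS _ Tfg') Sfg.
have d2 : L2 (fun x => -1 * f' x + f x) by apply: L2D => //; exact: L2Z.
have e2 : L2 (fun x => -1 * g' x + g x) by apply: L2D => //; exact: L2Z.
have eg : eqae (fun x => -1 * g' x + g x) (fun x => - i * (-1 * f' x + f x)).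
  move: e; apply: filterS => x h /h /= ex.
  transitivity (- (g' x - - i * f' x) + g x - i * (-1 * f' x)); first by ring.
  by rewrite ex; ring.
have := dS _ _ Sd; rewrite (inner_eqae d2 e2 d2 (L2Z _ d2) (eqae_refl _) eg).
rewrite Im_innerZ// ImN mulN1r oppr_ge0 => /(L2norm_eq0 d2) f0.
apply: (operator_eqae opT Tfg' f2 g2).
  by move: f0; apply: filterS => x h /h; rewrite mulN1r => /eqP; rewrite addrC subr_eq0 => /eqP.
move: f0 eg; rewrite /eqae; apply: filterS2 => x f0x egx Dx.
have := egx Dx; rewrite f0x// mulr0 mulN1r => /eqP; rewrite addrC subr_eq0 => /eqP ->//.
Qed.

(** Integrates the derivative [2 Re (conj u u')] of [|u|^2]. *)
Lemma integral_Re_conj_deriv u du : H1_repr u du ->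
  2 * Iv 0 c (fun x => Re (conjc (u x) * du x)) = normc (u c) ^+ 2 - normc (u 0) ^+ 2.
Proof.
move=> hu; have /H1P[ur _] := H1M (H1J hu) hu.
have i1 := (L2_integrableM (L2J (H1_L2 hu)) hu.1).1.
have ui := ac_incr ur (lexx _) (two_pi_ge0 R) (lexx _).
transitivity (Iv 0 c (fun x => Re (conjc (du x) * u x + conjc (u x) * du x))).
  rewrite -IvZ//; apply: eq_Rintegral => x _; rewrite /= !ReImE; ring.
transitivity (Re (conjc (u c) * u c) - Re (conjc (u 0) * u 0)); first by symmetry.
by rewrite !normc_sqr !ReImE; ring.
Qed.

(** * The extremal boundary condition and its uniqueness *)

Section Extremal.
Variables (V : R -> R[i]) (lambda : R).
Hypothesis V2 : L2 V.

(* The solution of [i f' + V^* f = lambda f] with [f (2 * pi) = 1]. *)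
Definition extremal x := conjc (fund V lambda%:C%C c) * conjc (fundV V lambda%:C%C x).
Definition extremal_rho := extremal 0.
Definition extremal_k x := (conjc (V x) - V x) * extremal x.

Definition dextremal x := i * (conjc (V x) - lambda%:C%C) * extremal x.

(** Conjugating the equation of [fundV] replaces [V] by its conjugate and leaves the real number
    [lambda] in place. *)
Lemma H1_extremal : H1_repr extremal dextremal.
Proof.
have := H1Z (conjc (fund V lambda%:C%C c)) (H1J (H1_fundV lambda%:C%C V2)).
congr H1_repr; apply/funext => x; rewrite /dextremal /extremal.
rewrite !(conjcM, conjcN, conjcD).
have -> : conjc i = - i by apply: complexP; rewrite !ReImE /= ?oppr0.
have -> : conjc (lambda%:C%C : R[i]) = lambda%:C%C by apply: complexP; rewrite !ReImE /= ?oppr0.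
by ring.
Qed.

Lemma extremal1 : extremal c = 1.
Proof. by rewrite /extremal -conjcM mulrC fundVK conjc1. Qed.

Lemma extremal_ode x : i * dextremal x + V x * extremal x + extremal_k x = lambda%:C%C * extremal x.
Proof.
rewrite /dextremal /extremal_k.
transitivity ((i * i) * (conjc (V x) - lambda%:C%C) * extremal x + conjc (V x) * extremal x).
  by ring.
by rewrite mulii; ring.
Qed.

Lemma L2_extremal_k : L2 extremal_k.
Proof. by apply: L2_mulH1 H1_extremal _; apply: L2B => //; exact: L2J. Qed.

(** Let [F] be [extremal] and [w = u c]. The potential and [k] contribute
    [Im V (|u|^2 - 2 Re (conj u w F))], which is [Im V |u - w F|^2] less [Im V |w F|^2]. By the
    equation of [F] the subtracted term is [Re (conj (w F) w F')], half the derivative of [|w F|^2].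
    Its integral cancels that of [Re (conj u u')], as [u] and [w F] have equal moduli at both
    ends. *)
Lemma extremal_dissipative : {ae mu, forall x, D x -> 0 <= Im (V x)} ->
  dissipative (A_op V extremal_rho extremal_k).
Proof.
move=> VI_ge0; have k2 := L2_extremal_k.
split; [exact: A_op_operator|exact: A_op_dense|].
move=> f g [/= f2 g2 [u [du [hu fu u0 gu]]]].
have u2 := H1_L2 hu.
have g'2 : L2 (fun x => i * du x + V x * u x + u c * extremal_k x).
  by apply: L2D; [apply: L2D; [exact: L2Z hu.1|exact: L2_mulH1 hu V2]|exact: L2Z].
rewrite -[X in 0 <= X]/(Im (inner f g)) (inner_eqae f2 g2 u2 g'2 fu gu).
set w := u c.
have hv := H1Z w H1_extremal.
have hq := H1B hu hv.
pose q x := u x - w * extremal x.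
have i1 := (L2_integrableM (L2J u2) hu.1).1.
have i2 := (L2_integrableM (L2J (H1_L2 hv)) hv.1).1.
have i3 : intg (fun x => Im (V x) * normc (q x) ^+ 2).
  apply: (eq_integrable02pi _ (L2_integrableM (L2J (H1_L2 hq)) (L2_mulH1 hq V2)).2) => x.
  by rewrite /= normc_sqr /q !ReImE; ring.
have -> : Im (inner u (fun x => i * du x + V x * u x + w * extremal_k x)) =
   Iv 0 c (fun x => (Re (conjc (u x) * du x) -
      Re (conjc (w * extremal x) * (w * dextremal x))) + Im (V x) * normc (q x) ^+ 2).
  apply: eq_Rintegral => x _; cbv beta; rewrite normc_sqr /q /extremal_k /dextremal.
  move: (extremal x) (V x) (u x) (du x) (w) => F Vx ux dux b.
  by rewrite !ReImE /=; ring.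
rewrite (IvD (intgB i1 i2) i3 (lexx _) (lexx _)) (IvB i1 i2 (lexx _) (lexx _)).
have e1 := integral_Re_conj_deriv hu; have e2 := integral_Re_conj_deriv hv.
have eb : normc (u 0) = normc (w * extremal 0) by rewrite u0 mulrC.
have ec : normc (u c) = normc (w * extremal c) by rewrite extremal1 mulr1.
rewrite /= -eb -ec in e2.
have -> : Iv 0 c (fun x => Re (conjc (u x) * du x)) -
  Iv 0 c (fun x => Re (conjc (w * extremal x) * (w * dextremal x))) = 0 by lra.
(* The sign of [Im V] is known only almost everywhere; the absolute value makes the integrand
   nonnegative at every point. *)
rewrite add0r (@eq_Iv_ae _ _ (fun x => `|Im (V x) * normc (q x) ^+ 2|)) ?lexx//.
- by apply: Iv_ge0.
- exact: intg_meas.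
- exact: intg_meas (intg_norm i3).
- move: VI_ge0; apply: (@filterS _ _ (ae_filter_ringOfSetsType mu)) => x h Dx.
  by rewrite ger0_norm// mulr_ge0 ?sqr_ge0 ?h.
Qed.

Lemma integralC_conj f : integrableC f -> cI (fun x => conjc (f x)) = conjc (cI f).
Proof.
move=> [fr fi]; apply: complexP; rewrite !ReImE /=.
- by apply: eq_Rintegral => x _; rewrite ReJ.
- rewrite -mulN1r -(RintegralZl _ (@measurable_interval02pi R) fi).
  by apply: eq_Rintegral => x _; rewrite ImJ mulN1r.
Qed.

Lemma integralC_cst a : cI (fun=> a) = a * (c%:C)%C.
Proof.
by apply: complexP; rewrite /= -IvE (Iv_cst _ (two_pi_ge0 R)) !ReImE /= subr0 mulr0 ?subr0 ?addr0 ?add0r.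
Qed.

Lemma eigenfunction_extremal rho k u du : L2 k ->
  dissipative (A_op V rho k) -> H1_repr u du -> u 0 = rho -> u c = 1 ->
  (forall x, i * du x + V x * u x + k x = lambda%:C%C * u x) ->
  rho = extremal_rho /\ eqae k extremal_k.
Proof.
move=> k2 [opT _ dT] hu u0 uc ode.
have u2 := H1_L2 hu.
set z := (lambda%:C)%C.
have Tu := @eigenfunction_graph _ _ _ z _ _ V2 k2 hu u0 uc (eqaeW ode).
pose E := fund V z.
have hE := H1_fund z V2.
have hphi := H1M (H1J hu) hE.
pose phi x := conjc (u x) * E x.
have phi2 : L2 phi := H1_L2 hphi.
have cC0 : (c%:C)%C != 0 :> R[i] by rewrite eq_complex /= gt_eqF ?two_pi_gt0.
pose m := cI phi / (c%:C)%C.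
have d2 : L2 (fun x => phi x - m) by apply: L2B => //; exact: L2_cst.
(* A single test function suffices: with the conjugate of the mean-free part of [phi], the integral
   of [phi * gam] is the squared norm of that part. *)
pose gam x := conjc (phi x - m).
have gam2 : L2 gam by exact: L2J.
have d0 : cI (fun x => phi x - m) = 0.
  rewrite (integralCD (L2_integrableC phi2) (L2_integrableC (L2_cst (- m)))) integralC_cst mulNr /m divfK//.
  by rewrite subrr.
have gam0 : cI gam = 0 by rewrite (integralC_conj (L2_integrableC d2)) d0 conjc0.
have hv := H1M hE (H1_int gam2).
pose v x := E x * integralC `]0, x[%classic gam.
have v0 : v 0 = 0 by rewrite /v integralC0 mulr0.
have vc : v c = 0 by rewrite /v [integralC _ _]gam0 mulr0.
(* As [E] solves the homogeneous equation, only the derivative of the other factor survives in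
   [(A - z) v]. *)
have Tv : A_op V rho k (v, fun x => z * v x + i * E x * gam x).
  have := @A_op_mem _ _ rho _ _ _ V2 k2 hv; rewrite -/(v 0) -/(v c) v0 vc mulr0.
  move=> /(_ erefl); congr A_op; congr pair; apply/funext => x.
  rewrite -/E /v; set J := integralC _ _.
  transitivity ((i * i) * (V x - z) * E x * J + i * E x * gam x + V x * (E x * J));
    first by ring.
  by rewrite mulii; ring.
have v2 := (operator_L2 opT Tv).1.
have s2 : L2 (fun x => i * E x * gam x).
  have := L2Z i (L2_mulH1 hE gam2); congr L2; apply/funext => x; rewrite /E; ring.
pose X := cI (fun x => conjc (u x) * (i * E x * gam x)).
pose Y := Im (cI (fun x => conjc (v x) * (i * E x * gam x))).
(* Since [z] is real and [(A - z) u = 0], the form at [a * u + v] is real-affine in [a]. Being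
   bounded below, it has no linear part, so [X] must vanish. *)
have key a : 0 <= Im (conjc a * X) + Y.
  have := dT _ _ (operator_linear opT a Tu Tv).
  pose q x := a * u x + v x.
  have q2 : L2 q by apply: L2D => //; exact: L2Z.
  have -> : inner (fun x => a * u x + v x)
      (fun x => a * (z * u x) + (z * v x + i * E x * gam x)) =
      inner q (fun x => z * q x) +
      (conjc a * X + cI (fun x => conjc (v x) * (i * E x * gam x))).
    have j1 := L2_integrableM (L2J u2) s2; have j2 := L2_integrableM (L2J v2) s2.
    have -> : conjc a * X = _ := esym (integralCZ (conjc a) j1).
    have -> := esym (integralCD (integrableCZ (conjc a) j1) j2).
    have -> := esym (integralCD (L2_integrableM (L2J q2) (L2Z z q2)) (integrableCD (integrableCZ (conjc a) j1) j2)).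
    congr integralC; apply/funext => x; rewrite /q conjcD conjcM; ring.
  by rewrite !ImD Im_innerZ// /z /= mul0r add0r.
have X0 : X = 0.
  apply: (@ComplexField.Normc.eq0_normc); apply/eqP; rewrite -sqrf_eq0.
  rewrite eq_le sqr_ge0 andbT leNgt; apply/negP => X0.
  (* With [a = i t X] the linear part is [- t |X|^2]; this [t] brings the form down to [-1]. *)
  pose t : R := (Y + 1) / normc X ^+ 2.
  have := key (i * (t%:C)%C * X).
  have -> : Im (conjc (i * (t%:C)%C * X) * X) = - t * normc X ^+ 2.
    by rewrite normc_sqr !ReImE /=; ring.
  by rewrite /t mulNr divfK ?gt_eqF//; lra.
have phigam : cI (fun x => phi x * gam x) = 0.
  apply: (mulfI (_ : i != 0)); first by rewrite eq_complex /= oner_eq0 andbF.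
  rewrite mulr0 -X0 -(integralCZ _ (L2_integrableM phi2 gam2)).
  by congr integralC; apply/funext => x; rewrite /phi; ring.
have dgam : cI (fun x => (phi x - m) * gam x) = 0.
  have -> : (fun x => (phi x - m) * gam x) = (fun x => phi x * gam x + - m * gam x).
    by apply/funext => x; ring.
  rewrite (integralCD (L2_integrableM phi2 gam2) (integrableCZ _ (L2_integrableC gam2))) phigam.
  by rewrite (integralCZ _ (L2_integrableC gam2)) gam0 mulr0 addr0.
have phim : eqae (fun x => phi x - m) (fun=> 0).
  apply: (L2norm_eq0 d2).
  have := congr1 Re dgam; rewrite /= => <-.
  rewrite le_eqVlt; apply/orP; left; apply/eqP.
  by apply: eq_Rintegral => x _; rewrite /gam !ReImE; ring.
have uae : eqae u (fun x => conjc m * conjc (fundV V z x)).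
  move: phim; apply: filterS => x h /h /eqP; rewrite subr_eq0 => /eqP <-.
  rewrite /phi conjcM conjcK -mulrA -conjcM (mulrC (E x)) fundVK.
  by rewrite conjc1 mulr1.
have hf := H1Z (conjc m) (H1J (H1_fundV z V2)).
have [um _] := H1_uniq hu hf uae.
(* The normalisation [u c = 1] fixes the one constant left free. *)
have mE : conjc m = conjc (E c).
  have := um c; rewrite two_pi_ge0 lexx uc => /(_ isT) e1.
  have : conjc (E c) = conjc m * (conjc (fundV V z c) * conjc (E c)).
    by rewrite mulrA -e1 mul1r.
  by rewrite -conjcM fundVK conjc1 mulr1 => ->.
have uext : eqae u extremal.
  by apply: (eqae_trans uae); apply: aeW => x _; rewrite mE.
have [ue due] := H1_uniq hu H1_extremal uext.
split.
  by rewrite -u0 ue// lexx two_pi_ge0.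
move: due; apply: filterS => x h Dx.
have e1 := ode x; have e2 := extremal_ode x.
apply: (addrI (i * du x + V x * u x)); rewrite e1.
by rewrite h// ue ?e2//; exact: interval02pi_le.
Qed.

End Extremal.
End Dissipative.

Theorem theorem4p9 (R : realType) (V : R -> R[i])
  (V_Linfty : Linfty V)
  (VI_ge0 : {ae @lebesgue_measure R, forall x, interval02pi R x -> 0 <= complex.Im (V x)})
  (VI_pos : (0 < @lebesgue_measure R [set x | interval02pi R x /\ (0 < complex.Im (V x))%R])%E)
  (lambda : R) :
  exists (rho : R[i]) (k : R -> R[i]),
    [/\ L2 k,
        [/\ maximally_dissipative (A_op V rho k),
            extension (A_min V) (A_op V rho k) &
            spectrum (A_op V rho k) lambda%:C%C] &
        forall (rho' : R[i]) (k' : R -> R[i]),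
          L2 k' ->
          maximally_dissipative (A_op V rho' k') ->
          extension (A_min V) (A_op V rho' k') ->
          spectrum (A_op V rho' k') lambda%:C%C ->
          rho' = rho /\ eqae k' k].
Proof.
have V2 := Linfty_L2 V_Linfty.
have k2 := L2_extremal_k lambda V2.
exists (extremal_rho V lambda), (extremal_k V lambda); split => //.
  split.
  - by apply: dissipative_maximal => //; exact: extremal_dissipative.
  - exact: A_min_sub.
  - apply: (eigenfunction_spectrum V2 k2 (H1_extremal lambda V2) erefl (extremal1 V lambda)).
    by apply: aeW => x _; exact: extremal_ode.
move=> rho' k' k'2 [dT _] _ spec.
have [res|[u [du [hu u0 uc ode]]]] :=
  resolvent_or_eigenfunction rho' lambda%:C%C V2 k'2; first by case: (spec res).
exact: (eigenfunction_extremal V2 k'2 dT hu u0 uc ode).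
Qed.
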